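(* Let $X$ be a real nonzero Banach space and $S,T:X\rightrightarrows X^*$ maximal monotone operators of Gossez type (D) with strong representative functions $h_S,h_T$ such that $\operatorname{pr}_{X^*}(\operatorname{dom}h_S)\cap\operatorname{pr}_{X^*}(\operatorname{dom}h_T)\neq\emptyset$ and $D(\overline S)\subseteq X$ (or $D(\overline T)\subseteq X$). Write $P:=\operatorname{pr}_{X^*}(\operatorname{dom}h_S)-\operatorname{pr}_{X^*}(\operatorname{dom}h_T)$. Then (a) ${}^{ic}(R(S)-R(T))=\operatorname{ri}(R(S)-R(T))={}^{ic}(\operatorname{co}R(S)-\operatorname{co}R(T))=\operatorname{ri}(\operatorname{co}R(S)-\operatorname{co}R(T))={}^{ic}P=\operatorname{ri}P$; (b) consequently the conditions $0\in{}^{ic}(R(S)-R(T))$, $0\in\operatorname{ri}(R(S)-R(T))$, $0\in{}^{ic}(\operatorname{co}R(S)-\operatorname{co}R(T))$, $0\in\operatorname{ri}(\operatorname{co}R(S)-\operatorname{co}R(T))$, $0\in{}^{ic}P$, $0\in\operatorname{ri}P$ are equivalent, and each implies that $S\|T$ is maximal monotone of Gossez type (D).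
   Context: $X$ identified with its image in $X^{**}$. $G,D,R$ graph, domain, range; $\operatorname{co}$ convex hull. Coupling $c(x,x^* )=\langle x^*,x\rangle$. Conjugate of $h$ on $X\times X^*$: $h^*(x^*,x^{**})=\sup_{(x,y^* )}\{\langle x^*,x\rangle+\langle x^{**},y^*\rangle-h(x,y^* )\}$. Representative function of monotone $S$: convex norm-lsc $h_S$ with $h_S\ge c$ and $G(S)\subseteq\{h_S=c\}$; strong if $h_S^*(x^*,x^{**})\ge\langle x^{**},x^*\rangle$ for all. Gossez's closure $\overline S:X^{**}\rightrightarrows X^*$ has graph $\{(x^{**},x^* ):\langle x^{**}-y,x^*-y^*\rangle\ge0\ \forall(y,y^* )\in G(S)\}$; maximal monotone $S$ is of Gossez type (D) if each point of $G(\overline S)$ is the $w^*\times\|\cdot\|_*$-limit of a bounded net in $G(S)$. $S\|T(x)=(S^{-1}+T^{-1})^{-1}(x)$. $\operatorname{icr}D=\{u:\forall x\in\operatorname{aff}(D-D)\ \exists\delta>0\ \forall\lambda\in[0,\delta]:u+\lambda x\in D\}$; ${}^{ic}D=\operatorname{icr}D$ if $\operatorname{aff}D$ closed, else $\emptyset$; $\operatorname{ri}D$ = interior relative to $\operatorname{aff}D$ if closed, else $\emptyset$. *)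

(* Defs.v *)
From Stdlib Require Import Reals Lra.
Open Scope R_scope.
Set Implicit Arguments.

Record Banach := {
  bcar :> Type;
  bzero : bcar;
  badd : bcar -> bcar -> bcar;
  bopp : bcar -> bcar;
  bscal : R -> bcar -> bcar;
  bnorm : bcar -> R;
  b_addA : forall x y z, badd x (badd y z) = badd (badd x y) z;
  b_addC : forall x y, badd x y = badd y x;
  b_add0 : forall x, badd x bzero = x;
  b_addN : forall x, badd x (bopp x) = bzero;
  b_scal1 : forall x, bscal 1 x = x;
  b_scalA : forall a b x, bscal a (bscal b x) = bscal (a * b) x;
  b_scalDr : forall a x y, bscal a (badd x y) = badd (bscal a x) (bscal a y);
  b_scalDl : forall a b x, bscal (a + b) x = badd (bscal a x) (bscal b x);
  b_norm_ge0 : forall x, 0 <= bnorm x;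
  b_norm_eq0 : forall x, bnorm x = 0 -> x = bzero;
  b_norm_scal : forall a x, bnorm (bscal a x) = Rabs a * bnorm x;
  b_norm_tri : forall x y, bnorm (badd x y) <= bnorm x + bnorm y;
  b_complete : forall u : nat -> bcar,
    (forall eps, 0 < eps -> exists N, forall m n, (N <= m)%nat -> (N <= n)%nat ->
        bnorm (badd (u m) (bopp (u n))) < eps) ->
    exists l, forall eps, 0 < eps -> exists N, forall n, (N <= n)%nat ->
        bnorm (badd (u n) (bopp l)) < eps
}.

Arguments bzero {_}.
Arguments badd {_}.
Arguments bopp {_}.
Arguments bscal {_}.
Arguments bnorm {_}.

Section Duality.
Variable X : Banach.

Definition bsub (x y : X) : X := badd x (bopp y).

Definition is_lin (f : X -> R) :=
  forall a x y, f (badd (bscal a x) y) = a * f x + f y.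
Definition dnorm_le (f : X -> R) (M : R) := forall x, Rabs (f x) <= M * bnorm x.
Definition is_dual (f : X -> R) := is_lin f /\ exists M, dnorm_le f M.
Definition dual := { f : X -> R | is_dual f }.
Definition dapp (f : dual) : X -> R := proj1_sig f.
Coercion dapp : dual >-> Funclass.

Lemma is_dual_comb (a b : R) (f g : X -> R) :
  is_dual f -> is_dual g -> is_dual (fun x => a * f x + b * g x).
Proof.
  intros [Lf [M1 Hf]] [Lg [M2 Hg]]. split.
  - intros c x y. rewrite Lf, Lg. ring.
  - exists (Rabs a * M1 + Rabs b * M2). intros x.
    eapply Rle_trans; [apply Rabs_triang|]. rewrite !Rabs_mult.
    specialize (Hf x). specialize (Hg x).
    assert (Rabs a * Rabs (f x) <= Rabs a * (M1 * bnorm x)) by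
      (apply Rmult_le_compat_l; [apply Rabs_pos|exact Hf]).
    assert (Rabs b * Rabs (g x) <= Rabs b * (M2 * bnorm x)) by
      (apply Rmult_le_compat_l; [apply Rabs_pos|exact Hg]).
    lra.
Qed.

Lemma is_dual_zero : is_dual (fun _ => 0).
Proof.
  split.
  - intros a x y. ring.
  - exists 0. intros x. rewrite Rabs_R0. lra.
Qed.

Definition dzero : dual := exist _ (fun _ => 0) is_dual_zero.
Definition dcomb (a : R) (f : dual) (b : R) (g : dual) : dual :=
  exist _ (fun x => a * f x + b * g x) (is_dual_comb a b (proj2_sig f) (proj2_sig g)).
Definition dsub (f g : dual) : dual := dcomb 1 f (-1) g.

Definition is_bidual (p : dual -> R) :=
  (forall a f b g, p (dcomb a f b g) = a * p f + b * p g) /\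
  (exists M, forall (f : dual) r, dnorm_le f r -> Rabs (p f) <= M * r).
Definition bidual := { p : dual -> R | is_bidual p }.
Definition bdapp (p : bidual) : dual -> R := proj1_sig p.
Coercion bdapp : bidual >-> Funclass.
Definition in_X (p : bidual) := exists x : X, forall f : dual, p f = f x.

Definition op := X -> dual -> Prop.

Definition monotone (S : op) :=
  forall x f y g, S x f -> S y g -> 0 <= (dsub f g) (bsub x y).
Definition maximal_monotone (S : op) :=
  monotone S /\
  forall T : op, monotone T -> (forall x f, S x f -> T x f) -> (forall x f, T x f -> S x f).

Definition gossez (S : op) (p : bidual) (f : dual) :=
  forall y g, S y g -> 0 <= p (dsub f g) - (dsub f g) y.

Definition directed (I : Type) (le : I -> I -> Prop) :=
  inhabited I /\ (forall i, le i i) /\ (forall i j k, le i j -> le j k -> le i k) /\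
  (forall i j, exists k, le i k /\ le j k).

Definition gossez_typeD (S : op) :=
  maximal_monotone S /\
  forall (p : bidual) (f : dual), gossez S p f ->
  exists (I : Type) (le : I -> I -> Prop) (xs : I -> X) (fs : I -> dual),
    directed le /\
    (forall i, S (xs i) (fs i)) /\
    (exists M, forall i, bnorm (xs i) <= M /\ dnorm_le (fs i) M) /\
    (forall (g : dual) eps, 0 < eps -> exists i0, forall i, le i0 i ->
        Rabs (g (xs i) - p g) < eps) /\
    (forall eps, 0 < eps -> exists i0, forall i, le i0 i -> dnorm_le (dsub (fs i) f) eps).

Inductive ereal := Fin (r : R) | PInf.

Definition closed_XXs (A : X -> dual -> Prop) :=
  forall x f, (forall eps, 0 < eps -> exists y g, A y g /\ bnorm (bsub x y) <= eps /\
                                                  dnorm_le (dsub f g) eps) -> A x f.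

Definition convex_fun (h : X -> dual -> ereal) :=
  forall x y f g l a b, 0 <= l <= 1 -> h x f = Fin a -> h y g = Fin b ->
    exists c, h (badd (bscal l x) (bscal (1 - l) y)) (dcomb l f (1 - l) g) = Fin c /\
              c <= l * a + (1 - l) * b.

Definition norm_lsc (h : X -> dual -> ereal) :=
  forall t, closed_XXs (fun x f => exists a, h x f = Fin a /\ a <= t).

Definition representative (S : op) (h : X -> dual -> ereal) :=
  convex_fun h /\ norm_lsc h /\
  (forall x f a, h x f = Fin a -> f x <= a) /\
  (forall x f, S x f -> h x f = Fin (f x)).

(* strong: h^*(f, p) >= <p, f> for all (f, p) in X^* x X^**, where
   h^*(f,p) = sup_{(x,g)} { f x + p g - h(x,g) }  (terms with h = +oo count as -oo) *)
Definition strong_representative (S : op) (h : X -> dual -> ereal) :=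
  representative S h /\
  forall (f : dual) (p : bidual) eps, 0 < eps ->
    exists x g a, h x g = Fin a /\ p f - eps < f x + p g - a.

Definition pr_dom (h : X -> dual -> ereal) (f : dual) := exists x a, h x f = Fin a.

Definition range (S : op) (f : dual) := exists x, S x f.
Definition inverse (S : op) : dual -> X -> Prop := fun f x => S x f.
Definition op_sum (A B : dual -> X -> Prop) : dual -> X -> Prop :=
  fun f x => exists u v, A f u /\ B f v /\ x = badd u v.
Definition inverse' (A : dual -> X -> Prop) : op := fun x f => A f x.
Definition parallel_sum (S T : op) : op := inverse' (op_sum (inverse S) (inverse T)).

Definition dset := dual -> Prop.
Definition set_diff (A B : dset) : dset := fun z => exists a b, A a /\ B b /\ z = dsub a b.
Definition convex (C : dset) :=
  forall a b l, C a -> C b -> 0 <= l <= 1 -> C (dcomb l a (1 - l) b).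
Definition co (A : dset) : dset :=
  fun z => forall C, convex C -> (forall a, A a -> C a) -> C z.
Definition affine (C : dset) := forall a b l, C a -> C b -> C (dcomb l a (1 - l) b).
Definition aff (A : dset) : dset :=
  fun z => forall C, affine C -> (forall a, A a -> C a) -> C z.
Definition closed_d (C : dset) :=
  forall f, (forall eps, 0 < eps -> exists g, C g /\ dnorm_le (dsub f g) eps) -> C f.
Definition icr (D : dset) : dset :=
  fun u => forall x, aff (set_diff D D) x ->
    exists delta, 0 < delta /\ forall l, 0 <= l <= delta -> D (dcomb 1 u l x).
Definition ic (D : dset) : dset := fun u => closed_d (aff D) /\ icr D u.
Definition ri (D : dset) : dset :=
  fun u => closed_d (aff D) /\ D u /\
    exists eps, 0 < eps /\ forall v, aff D v -> dnorm_le (dsub v u) eps -> D v.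
Definition set_eq (A B : dset) := forall z, A z <-> B z.

End Duality.

(* Main.v *)
Require Import Defs.
From Stdlib Require Import Reals Lra Lia List.
From Stdlib Require Import Classical ClassicalEpsilon.
From Stdlib Require Import FunctionalExtensionality PropExtensionality ProofIrrelevance.
From mathcomp Require boolp classical_sets.
Open Scope R_scope.
Set Implicit Arguments.

(** The parallel sum is represented by the convex function
    [h (x, f) = inf {hS (u, f) + hT (v, f) | u + v = x}]. If [0] is in [ic P], the Robinson-Ursescu
    theorem bounds the value function of the problem in which the two [X^*]-components may differ,
    so Fenchel duality holds with attainment:
    [h^* (f, p) = min_q (hS^* (f, p - q) + hT^* (f, q)) >= p f].
    The closure of [h] therefore has both [h >= c] and [h^* >= c], and any such function has a
    maximal monotone contact set [{h = c}] of type (D): approximate minimizers of [h - c] plus a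
    quadratic are improved to contact points by a Brondsted-Rockafellar iteration, this yields
    type (NI), and a second minimization over the convex hull of the contact set yields the nets of
    type (D). At a contact point [(x, f)], the optimal [q] puts [(x - q, f)] and [(q, f)] into
    Gossez's closures of [S] and [T]; the domain hypothesis forces both into [X], so the contact set
    is the graph of [S||T].

    Since a maximal monotone operator is not empty, applying this to [T] shifted by [z] shows
    [ic P <= R(S) - R(T)], hence [ri P = ic P] is contained in the other interiors. Conversely
    type (D) and separation give [pr dom hS <= cl co R(S)], so all affine hulls agree as soon as one
    of them is closed. *)

Arguments bsub {X} x y.
Arguments is_lin {X} f.
Arguments is_dual {X} f.
Arguments dnorm_le {X} f M.

Notation "x [+] y" := (badd x y) (at level 50, left associativity).
Notation "x [-] y" := (bsub x y) (at level 50, left associativity).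
Notation "a [*] x" := (bscal a x) (at level 40, left associativity).

(** Without reflexivity two obstacles shape the argument: a point [p] of the bidual cannot anchor a
    minimization over [X], and infima over [X] need not be attained. So [p] is replaced by a convex
    set [C] of vectors that has [p] in its weak-star closure, and closeness to [p] by closeness to
    some point of [C]; every minimizer is approximate, and exact contact points arise only as norm
    limits. The quadratic terms are [mu / 2 |y - c|^2] and [|g - f0|^2 / (2 mu)] because they are
    conjugate to each other: this is what lets [h^* >= c] force the perturbed infimum to be at most
    zero, for every weight [mu]. The weight is 1 when both components have to be controlled and
    small when only the component in the dual matters. All separation goes through a single sandwich
    theorem against a finite convex function. In the parallel sum that function is a multiple of the
    norm, and its slope is where the qualification condition enters. *)

Lemma choice_fun (A B : Type) (P : A -> B -> Prop) :
  (forall a, exists b, P a b) -> exists f, forall a, P a (f a).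
Proof.
  intros H. exists (fun a => proj1_sig (constructive_indefinite_description _ (H a))).
  intros a. apply (proj2_sig (constructive_indefinite_description _ (H a))).
Qed.

(** * Linear identities and norms *)

Section Basic.
Context {V : Banach}.
Implicit Types x y z : V.

Lemma badd0l x : bzero [+] x = x.
Proof. rewrite b_addC. apply b_add0. Qed.

Lemma badd_cancel x y z : x [+] y = x [+] z -> y = z.
Proof.
  intros H. rewrite <- (badd0l y), <- (badd0l z), <- (b_addN _ x), (b_addC _ x).
  now rewrite <- !b_addA, H.
Qed.

Lemma bscal0 x : 0 [*] x = bzero.
Proof.
  apply (@badd_cancel (0 [*] x)). rewrite <- b_scalDl, b_add0. f_equal. ring.
Qed.

Lemma bscal_zero a : a [*] (@bzero V) = bzero.
Proof. rewrite <- (bscal0 bzero), b_scalA. f_equal. ring. Qed.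

Lemma bopp_scal x : bopp x = (-1) [*] x.
Proof.
  apply (@badd_cancel x). rewrite b_addN. rewrite <- (b_scal1 _ x) at 1.
  rewrite <- b_scalDl. replace (1 + -1) with 0 by ring. now rewrite bscal0.
Qed.

Lemma badd_swap x y z (t : V) : (x [+] y) [+] (z [+] t) = (x [+] z) [+] (y [+] t).
Proof.
  rewrite <- !b_addA. f_equal. rewrite !b_addA. f_equal. apply b_addC.
Qed.

(** * Reflection of linear identities into equations between scalar coefficients *)

Inductive lexp : Type :=
| LVar (n : nat) | LZero | LAdd (e1 e2 : lexp) | LOpp (e : lexp) | LScal (r : R) (e : lexp).

Fixpoint lden (l : list V) (e : lexp) : V :=
  match e with
  | LVar n => nth n l bzero
  | LZero => bzero
  | LAdd e1 e2 => lden l e1 [+] lden l e2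
  | LOpp e => bopp (lden l e)
  | LScal r e => r [*] lden l e
  end.

Fixpoint lcoef (e : lexp) (i : nat) : R :=
  match e with
  | LVar n => if Nat.eqb n i then 1 else 0
  | LZero => 0
  | LAdd e1 e2 => lcoef e1 i + lcoef e2 i
  | LOpp e => - lcoef e i
  | LScal r e => r * lcoef e i
  end.

Fixpoint lsum (l : list V) (c : nat -> R) : V :=
  match l with
  | nil => bzero
  | cons x l => c O [*] x [+] lsum l (fun i => c (S i))
  end.

Lemma lsum_add l c d : lsum l (fun i => c i + d i) = lsum l c [+] lsum l d.
Proof.
  revert c d. induction l as [|x l IH]; intros c d; simpl.
  - now rewrite b_add0.
  - rewrite (IH (fun i => c (S i)) (fun i => d (S i))), b_scalDl. apply badd_swap.
Qed.

Lemma lsum_scal l a c : lsum l (fun i => a * c i) = a [*] lsum l c.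
Proof.
  revert c. induction l as [|x l IH]; intros c; simpl.
  - now rewrite bscal_zero.
  - now rewrite (IH (fun i => c (S i))), b_scalDr, b_scalA.
Qed.

Lemma lsum_ext l c d :
  (forall i, (i < length l)%nat -> c i = d i) -> lsum l c = lsum l d.
Proof.
  revert c d. induction l as [|x l IH]; intros c d H; simpl; [reflexivity|].
  rewrite (H O) by (simpl; lia). f_equal. apply IH. intros i Hi. apply H. simpl. lia.
Qed.

Lemma lsum0 l : lsum l (fun _ => 0) = bzero.
Proof. induction l as [|x l IH]; simpl; [reflexivity|]. now rewrite IH, bscal0, b_add0. Qed.

Lemma lden_sum l e : lden l e = lsum l (lcoef e).
Proof.
  induction e as [n| |e1 IH1 e2 IH2|e IH|r e IH]; simpl.
  - revert n. induction l as [|x l IH]; intros n; simpl.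
    + now destruct n.
    + destruct n as [|n]; simpl.
      * now rewrite b_scal1, lsum0, b_add0.
      * rewrite bscal0, badd0l. apply IH.
  - now rewrite lsum0.
  - now rewrite lsum_add, IH1, IH2.
  - rewrite bopp_scal, IH, <- lsum_scal. apply lsum_ext. intros. ring.
  - now rewrite IH, <- lsum_scal.
Qed.

Fixpoint leqs (n : nat) (e1 e2 : lexp) : Prop :=
  match n with O => True | S n => lcoef e1 n = lcoef e2 n /\ leqs n e1 e2 end.

Lemma lden_eq l e1 e2 : leqs (length l) e1 e2 -> lden l e1 = lden l e2.
Proof.
  intros H. rewrite !lden_sum. apply lsum_ext. revert H. generalize (length l).
  induction n as [|n IH]; simpl; intros H i Hi; [lia|].
  destruct H as [H1 H2]. destruct (Nat.eq_dec i n) as [->|]; [exact H1|]. apply IH; [exact H2|lia].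
Qed.
End Basic.

Ltac l_mem x l :=
  match l with
  | nil => constr:(false)
  | cons x _ => constr:(true)
  | cons _ ?l => l_mem x l
  end.
Ltac l_idx x l :=
  match l with
  | cons x _ => constr:(O)
  | cons _ ?l => let n := l_idx x l in constr:(S n)
  end.
Ltac l_atoms l e :=
  match e with
  | badd ?a ?b => let l := l_atoms l a in l_atoms l b
  | bsub ?a ?b => let l := l_atoms l a in l_atoms l b
  | bopp ?a => l_atoms l a
  | bscal _ ?a => l_atoms l a
  | bzero => l
  | ?x => match l_mem x l with true => l | false => constr:(cons x l) end
  end.
Ltac l_reify l e :=
  match e with
  | badd ?a ?b => let a := l_reify l a in let b := l_reify l b in constr:(LAdd a b)
  | bsub ?a ?b => let a := l_reify l a in let b := l_reify l b in constr:(LAdd a (LOpp b))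
  | bopp ?a => let a := l_reify l a in constr:(LOpp a)
  | bscal ?r ?a => let a := l_reify l a in constr:(LScal r a)
  | bzero => constr:(LZero)
  | ?x => let n := l_idx x l in constr:(LVar n)
  end.
(* Decides equalities of linear combinations by comparing the coefficients of each atom; the
   scalar equations that neither [ring] nor [field] settles are left over. *)
Ltac vlin :=
  match goal with
  | |- @eq (bcar ?V) ?a ?b =>
      let l := l_atoms (@nil (bcar V)) a in
      let l := l_atoms l b in
      let ea := l_reify l a in
      let eb := l_reify l b in
      change (@lden V l ea = @lden V l eb);
      apply lden_eq; cbn [leqs length lcoef Nat.eqb]; repeat split; try ring; try field; try lra
  end.

Section Norms.
Context {V : Banach}.
Implicit Types x y z : V.

Lemma bnorm0 : bnorm (@bzero V) = 0.
Proof. rewrite <- (bscal0 (@bzero V)), b_norm_scal, Rabs_R0. ring. Qed.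

Lemma bnorm_opp x : bnorm (bopp x) = bnorm x.
Proof. rewrite bopp_scal, b_norm_scal, Rabs_left by lra. ring. Qed.

Lemma bnorm_sub_sym x y : bnorm (x [-] y) = bnorm (y [-] x).
Proof. rewrite <- bnorm_opp. f_equal. vlin. Qed.

Lemma bnorm_sub_tri x y z : bnorm (x [-] z) <= bnorm (x [-] y) + bnorm (y [-] z).
Proof. replace (x [-] z) with ((x [-] y) [+] (y [-] z)) by vlin. apply b_norm_tri. Qed.

Lemma bnorm_sub_le x y : bnorm (x [-] y) <= bnorm x + bnorm y.
Proof. unfold bsub. rewrite <- (bnorm_opp y). apply b_norm_tri. Qed.

Lemma bnorm_le_sub x y : bnorm x <= bnorm (x [-] y) + bnorm y.
Proof. replace x with ((x [-] y) [+] y) at 1 by vlin. apply b_norm_tri. Qed.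

Lemma bsub_self x : x [-] x = bzero.
Proof. vlin. Qed.

Lemma bnorm_pscal a x : 0 <= a -> bnorm (a [*] x) = a * bnorm x.
Proof. intros Ha. now rewrite b_norm_scal, Rabs_right by lra. Qed.

Lemma bnorm_comb l x y : 0 <= l <= 1 ->
  bnorm (l [*] x [+] (1 - l) [*] y) <= l * bnorm x + (1 - l) * bnorm y.
Proof.
  intros Hl. eapply Rle_trans; [apply b_norm_tri|].
  rewrite !bnorm_pscal by lra. lra.
Qed.

Lemma bnorm_sub_eq0 x y : (forall eps, 0 < eps -> bnorm (x [-] y) <= eps) -> x = y.
Proof.
  intros H. assert (E : x [-] y = bzero).
  { apply b_norm_eq0. apply Rle_antisym; [|apply b_norm_ge0].
    apply Rnot_lt_le. intros C. specialize (H (bnorm (x [-] y) / 2)). lra. }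
  replace x with ((x [-] y) [+] y) by vlin. rewrite E. vlin.
Qed.
End Norms.

(** * Linear functionals *)

Section Linear.
Context {V : Banach}.
Variable f : V -> R.
Hypothesis Lf : is_lin f.

Lemma lin_zero : f bzero = 0.
Proof.
  assert (H := Lf 1 bzero bzero). rewrite b_add0, bscal_zero in H. lra.
Qed.
Lemma lin_add x y : f (x [+] y) = f x + f y.
Proof. assert (H := Lf 1 x y). rewrite b_scal1 in H. lra. Qed.
Lemma lin_scal a x : f (a [*] x) = a * f x.
Proof. assert (H := Lf a x bzero). rewrite b_add0, lin_zero in H. lra. Qed.
Lemma lin_opp x : f (bopp x) = - f x.
Proof. rewrite bopp_scal, lin_scal. ring. Qed.
Lemma lin_sub x y : f (x [-] y) = f x - f y.
Proof. unfold bsub. rewrite lin_add, lin_opp. ring. Qed.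

(** The unit ball is symmetric, so a one-sided bound suffices; this is the form in which a sandwich
    inequality delivers continuity. *)
Lemma lin_bounded_dual K : (forall x, bnorm x <= 1 -> f x <= K) -> is_dual f.
Proof.
  intros H. split; [exact Lf|]. exists K.
  assert (H0 : forall x, f x <= K * bnorm x).
  { intros x. destruct (Req_dec (bnorm x) 0) as [E|E].
    - apply b_norm_eq0 in E. subst. rewrite lin_zero, bnorm0. lra.
    - assert (P : 0 < bnorm x) by (assert (Q := b_norm_ge0 _ x); lra).
      assert (H1 := H (/ bnorm x [*] x)).
      rewrite bnorm_pscal, Rinv_l, lin_scal in H1
        by (try assumption; left; now apply Rinv_0_lt_compat).
      specialize (H1 (Rle_refl 1)).
      apply Rmult_le_compat_r with (r := bnorm x) in H1; [|lra].
      replace (/ bnorm x * f x * bnorm x) with (f x) in H1 by (field; lra). exact H1. }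
  intros x. apply Rabs_le. split; [|apply H0].
  specialize (H0 (bopp x)). rewrite lin_opp, bnorm_opp in H0. lra.
Qed.
End Linear.

Lemma dual_lin (X : Banach) (f : dual X) : is_lin f.
Proof. apply (proj1 (proj2_sig f)). Qed.

Ltac lin_simpl := repeat first
  [ rewrite lin_add by (first [assumption | apply dual_lin])
  | rewrite lin_sub by (first [assumption | apply dual_lin])
  | rewrite lin_scal by (first [assumption | apply dual_lin])
  | rewrite lin_opp by (first [assumption | apply dual_lin])
  | rewrite lin_zero by (first [assumption | apply dual_lin]) ].

Lemma dual_ext (X : Banach) (f g : dual X) : (forall x, f x = g x) -> f = g.
Proof.
  intros H. destruct f as [f Hf], g as [g Hg]. simpl in H.
  assert (f = g) by (now apply functional_extensionality). subst.
  f_equal. apply proof_irrelevance.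
Qed.

Ltac dual_ring := apply dual_ext; intros; simpl; first [ring | field; lra].

(** * Products, the reals and the dual as Banach spaces *)

Lemma cauchy_real (u : nat -> R) :
  (forall eps, 0 < eps -> exists N, forall m n, (N <= m)%nat -> (N <= n)%nat ->
     Rabs (u m + - u n) < eps) ->
  exists l, forall eps, 0 < eps -> exists N, forall n, (N <= n)%nat -> Rabs (u n + - l) < eps.
Proof.
  intros H. destruct (R_complete u) as [l Hl].
  - intros eps He. destruct (H eps He) as [N HN]. exists N. intros m n Hm Hn. now apply HN.
  - exists l. intros eps He. destruct (Hl eps He) as [N HN]. exists N. intros n Hn. now apply HN.
Qed.

Definition RB : Banach.
Proof.
  refine (@Build_Banach R 0 Rplus Ropp Rmult Rabs _ _ _ _ _ _ _ _ _ _ _ _ cauchy_real);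
  intros; try ring.
  - apply Rabs_pos.
  - destruct (Req_dec x 0) as [|E]; [assumption|]. now apply Rabs_no_R0 in E.
  - apply Rabs_mult.
  - apply Rabs_triang.
Defined.

Section Prod.
Variables X Y : Banach.

Lemma prod_complete (u : nat -> X * Y) :
  (forall eps, 0 < eps -> exists N, forall m n, (N <= m)%nat -> (N <= n)%nat ->
     bnorm (fst (u m) [+] bopp (fst (u n))) + bnorm (snd (u m) [+] bopp (snd (u n))) < eps) ->
  exists l : X * Y, forall eps, 0 < eps -> exists N, forall n, (N <= n)%nat ->
     bnorm (fst (u n) [+] bopp (fst l)) + bnorm (snd (u n) [+] bopp (snd l)) < eps.
Proof.
  intros H.
  destruct (b_complete _ (fun n => fst (u n))) as [a Ha].
  { intros eps He. destruct (H eps He) as [N HN]. exists N. intros m n Hm Hn.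
    specialize (HN m n Hm Hn).
    assert (Q := b_norm_ge0 _ (snd (u m) [+] bopp (snd (u n)))). lra. }
  destruct (b_complete _ (fun n => snd (u n))) as [b Hb].
  { intros eps He. destruct (H eps He) as [N HN]. exists N. intros m n Hm Hn.
    specialize (HN m n Hm Hn).
    assert (Q := b_norm_ge0 _ (fst (u m) [+] bopp (fst (u n)))). lra. }
  exists (a, b). intros eps He.
  destruct (Ha (eps / 2)) as [N1 H1]; [lra|]. destruct (Hb (eps / 2)) as [N2 H2]; [lra|].
  exists (max N1 N2). intros n Hn. simpl.
  assert (A := H1 n ltac:(lia)). assert (B := H2 n ltac:(lia)). lra.
Qed.

(** The sum norm. The definition is transparent so that [change] can split a norm into its
    components. *)
Definition prodB : Banach.
Proof.
  refine (@Build_Banach (X * Y) (bzero, bzero)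
    (fun p q => (fst p [+] fst q, snd p [+] snd q))
    (fun p => (bopp (fst p), bopp (snd p)))
    (fun a p => (a [*] fst p, a [*] snd p))
    (fun p => bnorm (fst p) + bnorm (snd p))
    _ _ _ _ _ _ _ _ _ _ _ _ prod_complete);
  try solve [intros; repeat match goal with x : (_ * _)%type |- _ => destruct x end; simpl in *;
    f_equal; vlin].
  - intros [x y]. simpl. assert (A := b_norm_ge0 _ x). assert (B := b_norm_ge0 _ y). lra.
  - intros [x y]. simpl. intros H. assert (A := b_norm_ge0 _ x). assert (B := b_norm_ge0 _ y).
    f_equal; apply b_norm_eq0; lra.
  - intros a [x y]. simpl. rewrite !b_norm_scal. ring.
  - intros [x y] [x' y']. simpl.
    assert (A := b_norm_tri _ x x'). assert (B := b_norm_tri _ y y'). lra.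
Defined.
End Prod.

Section DualBanach.
Variable X : Banach.
Implicit Types f g : dual X.

Definition unit_values (f : dual X) (r : R) := exists x, bnorm x <= 1 /\ r = Rabs (f x).

Lemma unit_values_bound f : bound (unit_values f).
Proof.
  destruct (proj2_sig f) as [_ [M HM]]. exists (Rabs M). intros r [x [Hx ->]].
  eapply Rle_trans; [apply HM|]. assert (A := b_norm_ge0 _ x).
  assert (B := Rle_abs M). assert (C := Rabs_pos M). nra.
Qed.

Lemma unit_values_ex f : exists r, unit_values f r.
Proof. exists (Rabs (f bzero)), bzero. split; [rewrite bnorm0; lra|reflexivity]. Qed.

(** [dnorm_le] is only a relation; the least bound turns the dual into a [Banach], so that all
    results on Banach spaces apply to it. *)
Definition dnorm (f : dual X) : R :=
  proj1_sig (completeness (unit_values f) (unit_values_bound f) (unit_values_ex f)).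

Lemma dnorm_lub f : is_lub (unit_values f) (dnorm f).
Proof. unfold dnorm. apply proj2_sig. Qed.

Lemma dnorm_ge0 f : 0 <= dnorm f.
Proof.
  destruct (dnorm_lub f) as [H _]. destruct (unit_values_ex f) as [r Hr].
  specialize (H r Hr). destruct Hr as [x [_ ->]]. assert (A := Rabs_pos (f x)). lra.
Qed.

Lemma dnorm_bound f : dnorm_le f (dnorm f).
Proof.
  intros x. destruct (Req_dec (bnorm x) 0) as [E|E].
  - apply b_norm_eq0 in E. subst. lin_simpl. rewrite bnorm0, Rabs_R0. lra.
  - assert (P : 0 < bnorm x) by (assert (Q := b_norm_ge0 _ x); lra).
    assert (H : Rabs (f (/ bnorm x [*] x)) <= dnorm f).
    { apply (proj1 (dnorm_lub f)). eexists; split; [|reflexivity].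
      rewrite bnorm_pscal by (left; now apply Rinv_0_lt_compat). rewrite Rinv_l; lra. }
    rewrite lin_scal, Rabs_mult, Rabs_inv, (Rabs_right (bnorm x)) in H
      by (first [apply dual_lin|lra]).
    apply Rmult_le_compat_r with (r := bnorm x) in H; [|lra].
    replace (/ bnorm x * Rabs (f x) * bnorm x) with (Rabs (f x)) in H by (field; lra). exact H.
Qed.

Lemma dnorm_least f r : 0 <= r -> dnorm_le f r -> dnorm f <= r.
Proof.
  intros Hr H. apply (proj2 (dnorm_lub f)). intros s [x [Hx ->]].
  specialize (H x). assert (A := b_norm_ge0 _ x). nra.
Qed.

Lemma dnorm_le_mono f r s : r <= s -> dnorm_le f r -> dnorm_le f s.
Proof. intros H1 H2 x. specialize (H2 x). assert (A := b_norm_ge0 _ x). nra. Qed.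

Lemma dnorm_tri f g : dnorm (dcomb 1 f 1 g) <= dnorm f + dnorm g.
Proof.
  assert (A := dnorm_ge0 f). assert (B := dnorm_ge0 g).
  apply dnorm_least; [lra|]. intros x. simpl.
  eapply Rle_trans; [apply Rabs_triang|]. rewrite !Rmult_1_l.
  assert (A' := dnorm_bound f x). assert (B' := dnorm_bound g x). simpl in *. lra.
Qed.

Lemma dnorm_scal_le a f : dnorm (dcomb a f 0 (dzero X)) <= Rabs a * dnorm f.
Proof.
  assert (A := dnorm_ge0 f). assert (B := Rabs_pos a).
  apply dnorm_least; [nra|]. intros x. simpl.
  replace (a * f x + 0 * 0) with (a * f x) by ring. rewrite Rabs_mult.
  assert (A' := dnorm_bound f x). nra.
Qed.

Lemma dnorm_scal a f : dnorm (dcomb a f 0 (dzero X)) = Rabs a * dnorm f.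
Proof.
  apply Rle_antisym; [apply dnorm_scal_le|].
  destruct (Req_dec a 0) as [->|Ha].
  - rewrite Rabs_R0, Rmult_0_l. apply dnorm_ge0.
  - assert (H := dnorm_scal_le (/ a) (dcomb a f 0 (dzero X))).
    replace (dcomb (/ a) (dcomb a f 0 (dzero X)) 0 (dzero X)) with f in H
      by (apply dual_ext; intros x; simpl; field; exact Ha).
    rewrite Rabs_inv in H. assert (P := Rabs_pos_lt a Ha).
    apply Rmult_le_compat_l with (r := Rabs a) in H; [|lra].
    rewrite <- Rmult_assoc, Rinv_r, Rmult_1_l in H by lra. exact H.
Qed.

Lemma dnorm_eq0 f : dnorm f = 0 -> f = dzero X.
Proof.
  intros H. apply dual_ext. intros x. simpl. assert (A := dnorm_bound f x).
  rewrite H, Rmult_0_l in A. assert (B := Rabs_pos (f x)).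
  destruct (Req_dec (f x) 0) as [|E]; [assumption|]. apply Rabs_pos_lt in E. lra.
Qed.

Lemma dual_complete (u : nat -> dual X) :
  (forall eps, 0 < eps -> exists N, forall m n, (N <= m)%nat -> (N <= n)%nat ->
     dnorm (dcomb 1 (u m) 1 (dcomb (-1) (u n) 0 (dzero X))) < eps) ->
  exists l, forall eps, 0 < eps -> exists N, forall n, (N <= n)%nat ->
     dnorm (dcomb 1 (u n) 1 (dcomb (-1) l 0 (dzero X))) < eps.
Proof.
  intros H.
  assert (H1 : forall eps, 0 < eps -> exists N, forall m n, (N <= m)%nat -> (N <= n)%nat ->
     forall x, Rabs (u m x - u n x) <= eps * bnorm x).
  { intros eps He. destruct (H eps He) as [N HN]. exists N. intros m n Hm Hn x.
    specialize (HN m n Hm Hn). assert (A := dnorm_bound _ x : Rabs (dcomb 1 (u m) 1 (dcomb (-1) (u n) 0 (dzero X)) x) <= _).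
    simpl in A. replace (1 * u m x + 1 * (-1 * u n x + 0 * 0)) with (u m x - u n x) in A by ring.
    assert (B := b_norm_ge0 _ x). nra. }
  assert (H2 : forall x, exists l, Un_cv (fun n => u n x) l).
  { intros x. destruct (R_complete (fun n => u n x)) as [l Hl]; [|now exists l].
    intros eps He. assert (B := b_norm_ge0 _ x).
    destruct (H1 (eps / (bnorm x + 1))) as [N HN]; [apply Rdiv_lt_0_compat; lra|].
    exists N. intros m n Hm Hn. specialize (HN m n Hm Hn x). unfold Rdist.
    eapply Rle_lt_trans; [exact HN|].
    replace eps with (eps / (bnorm x + 1) * (bnorm x + 1)) at 2 by (field; lra).
    apply Rmult_lt_compat_l; [apply Rdiv_lt_0_compat; lra|lra]. }
  destruct (choice_fun _ H2) as [l Hl'].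
  assert (H3 : forall eps, 0 < eps -> exists N, forall n, (N <= n)%nat ->
     forall x, Rabs (u n x - l x) <= eps * bnorm x).
  { intros eps He. destruct (H1 eps He) as [N HN]. exists N. intros n Hn x.
    apply Rnot_lt_le. intros C.
    destruct (Hl' x (Rabs (u n x - l x) - eps * bnorm x)) as [N' HN']; [lra|].
    specialize (HN' (max N N') ltac:(lia)). specialize (HN n (max N N') Hn ltac:(lia) x).
    unfold Rdist in HN'.
    assert (T := Rabs_triang (u n x - u (max N N') x) (u (max N N') x - l x)).
    replace (u n x - u (max N N') x + (u (max N N') x - l x)) with (u n x - l x) in T by ring.
    lra. }
  assert (Dl : is_dual l).
  { split.
    - intros a x y.
      apply (UL_sequence (fun n => u n (a [*] x [+] y))); [apply Hl'|].
      apply (Un_cv_ext (fun n => a * u n x + u n y)).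
      { intros n. lin_simpl. ring. }
      apply CV_plus; [|apply Hl'].
      apply (CV_mult (fun _ => a)); [|apply Hl'].
      intros eps He. exists O. intros. rewrite Rdist_eq. exact He.
    - destruct (H3 1 Rlt_0_1) as [N HN]. exists (dnorm (u N) + 1). intros x.
      specialize (HN N (le_n N) x). assert (A := dnorm_bound (u N) x).
      assert (T := Rabs_triang (u N x) (- (u N x - l x))). rewrite Rabs_Ropp in T.
      replace (u N x + - (u N x - l x)) with (l x) in T by ring. simpl in *. lra. }
  exists (exist _ l Dl). intros eps He.
  destruct (H3 (eps / 2)) as [N HN]; [lra|]. exists N. intros n Hn.
  apply Rle_lt_trans with (eps / 2); [|lra].
  apply dnorm_least; [lra|]. intros x. simpl.
  replace (1 * u n x + 1 * (-1 * l x + 0 * 0)) with (u n x - l x) by ring. now apply HN.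
Qed.

Definition dualB : Banach.
Proof.
  refine (@Build_Banach (dual X) (dzero X) (fun f g => dcomb 1 f 1 g)
    (fun f => dcomb (-1) f 0 (dzero X)) (fun a f => dcomb a f 0 (dzero X)) dnorm
    _ _ _ _ _ _ _ _ _ _ _ _ dual_complete);
  try (intros; apply dual_ext; intros; simpl; ring).
  - exact dnorm_ge0.
  - exact dnorm_eq0.
  - exact dnorm_scal.
  - exact dnorm_tri.
Defined.
End DualBanach.

(** * Sublinear functionals and the sandwich theorem *)

(** The imported form of Zorn's lemma has a boolean relation; [boolp.asbool] carries a propositional
    order to it. *)
Lemma zorn (T : Type) (le : T -> T -> Prop) :
  (forall t, le t t) -> (forall r s t, le r s -> le s t -> le r t) ->
  (forall s t, le s t -> le t s -> s = t) ->
  (forall A : T -> Prop, (forall s t, A s -> A t -> le s t \/ le t s) ->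
     exists t, forall s, A s -> le s t) ->
  exists t, forall s, le t s -> s = t.
Proof.
  intros Hr Ht Ha Hc.
  assert (E : forall s t, is_true (boolp.asbool (le s t)) <-> le s t).
  { intros s t. split; [apply boolp.asboolW|apply boolp.asboolT]. }
  destruct (@classical_sets.Zorn T (fun s t => boolp.asbool (le s t))) as [t Hmax].
  - intros t. now apply E.
  - intros r s t H1 H2. apply E. apply (Ht r s t); now apply E.
  - intros s t H1 H2. apply Ha; now apply E.
  - intros A HA. destruct (Hc A) as [t Hub].
    + intros s t Hs Hs'. specialize (HA s t Hs Hs').
      destruct HA as [H|H]; [left|right]; apply E; exact H.
    + exists t. intros s Hs. apply E. now apply Hub.
  - exists t. intros s Hs. apply Hmax. now apply E.
Qed.

Lemma real_glb (S : R -> Prop) (b : R) :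
  (exists s, S s) -> (forall s, S s -> b <= s) ->
  exists m, (forall s, S s -> m <= s) /\ (forall c, (forall s, S s -> c <= s) -> c <= m).
Proof.
  intros [s0 Hs0] Hb.
  destruct (completeness (fun r => S (- r))) as [m [H1 H2]].
  - exists (- b). intros r Hr. specialize (Hb _ Hr). lra.
  - exists (- s0). now rewrite Ropp_involutive.
  - exists (- m). split.
    + intros s Hs. assert (- s <= m); [|lra]. apply H1. now rewrite Ropp_involutive.
    + intros c Hc. assert (m <= - c); [|lra]. apply H2. intros r Hr. specialize (Hc _ Hr). lra.
Qed.

Lemma real_glb_fun (A : Type) (S : A -> R -> Prop) (b : A -> R) :
  (forall v, exists s, S v s) -> (forall v s, S v s -> b v <= s) ->
  exists m : A -> R, (forall v s, S v s -> m v <= s) /\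
    (forall v c, (forall s, S v s -> c <= s) -> c <= m v).
Proof.
  intros H1 H2.
  assert (H : forall v, exists m, (forall s, S v s -> m <= s) /\
                                  (forall c, (forall s, S v s -> c <= s) -> c <= m)).
  { intros v. apply (@real_glb _ (b v)); auto. }
  destruct (choice_fun _ H) as [m Hm]. exists m. split; intros v; apply Hm.
Qed.

Section Sublinear.
Context {V : Banach}.
Implicit Types v w : V.

Definition sublinear (Q : V -> R) :=
  (forall v w, Q (v [+] w) <= Q v + Q w) /\ (forall t v, 0 < t -> Q (t [*] v) = t * Q v).

(** The reverse inequality is the assumed one for [/ t] at the vector [t [*] v]. *)
Lemma pos_homogeneous_of_le (Q : V -> R) :
  (forall t v, 0 < t -> t * Q v <= Q (t [*] v)) -> forall t v, 0 < t -> Q (t [*] v) = t * Q v.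
Proof.
  intros Hle t v Ht. apply Rle_antisym; [|now apply Hle].
  assert (A := Hle (/ t) (t [*] v) (Rinv_0_lt_compat _ Ht)).
  rewrite b_scalA, Rinv_l, b_scal1 in A by lra.
  apply Rmult_le_compat_l with (r := t) in A; [|lra].
  rewrite <- Rmult_assoc, Rinv_r, Rmult_1_l in A by lra. exact A.
Qed.

Lemma sublinear0 Q : sublinear Q -> Q bzero = 0.
Proof.
  intros [_ H]. specialize (H 2 bzero). rewrite bscal_zero in H. specialize (H ltac:(lra)). lra.
Qed.

Lemma sublinear_opp Q v : sublinear Q -> - Q (bopp v) <= Q v.
Proof.
  intros H. assert (A := proj1 H v (bopp v)). rewrite b_addN, (sublinear0 H) in A. lra.
Qed.

Lemma sublinear_scal_ge0 Q t v : sublinear Q -> 0 <= t -> Q (t [*] v) = t * Q v.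
Proof.
  intros H [Ht|<-]; [now apply H|]. rewrite bscal0, (sublinear0 H). ring.
Qed.

(** For fixed [w], the infimum over [t >= 0] of [Q (v + t w) - t Q w] is a sublinear function of [v]
    below [Q]. Minimality forces it to equal [Q], and [t = 1] then gives superadditivity. *)
Lemma sublinear_minimal_lin Q : sublinear Q ->
  (forall Q', sublinear Q' -> (forall v, Q' v <= Q v) -> forall v, Q v <= Q' v) -> is_lin Q.
Proof.
  intros SQ Hmin.
  assert (Hsup : forall v w, Q v + Q w <= Q (v [+] w)).
  { intros v w.
    destruct (@real_glb_fun V (fun v r => exists t, 0 <= t /\ r = Q (v [+] t [*] w) - t * Q w)
                (fun v => - Q (bopp v))) as [Q' [L1 L2]].
    - intros u. exists (Q (u [+] 0 [*] w) - 0 * Q w), 0. split; [lra|reflexivity].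
    - intros u r [t [Ht ->]].
      assert (A := proj1 SQ (u [+] t [*] w) (bopp u)).
      replace ((u [+] t [*] w) [+] bopp u) with (t [*] w) in A by vlin.
      rewrite (sublinear_scal_ge0 w SQ Ht) in A. lra.
    - assert (SQ' : sublinear Q').
      { split.
        - intros a b.
          assert (Q' (a [+] b) - Q' b <= Q' a); [|lra]. apply L2. intros r [t [Ht ->]].
          assert (Q' (a [+] b) - (Q (a [+] t [*] w) - t * Q w) <= Q' b); [|lra].
          apply L2. intros r [s [Hs ->]].
          assert (A : Q' (a [+] b) <= Q ((a [+] b) [+] (t + s) [*] w) - (t + s) * Q w).
          { apply L1. exists (t + s). split; [lra|reflexivity]. }
          assert (B := proj1 SQ (a [+] t [*] w) (b [+] s [*] w)).
          replace ((a [+] t [*] w) [+] (b [+] s [*] w)) with ((a [+] b) [+] (t + s) [*] w) in B by vlin.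
          lra.
        - apply pos_homogeneous_of_le. intros s a Hs. apply L2. intros r [t [Ht ->]].
          replace (s [*] a [+] t [*] w) with (s [*] (a [+] (t / s) [*] w)) by vlin.
          rewrite (proj2 SQ) by exact Hs.
          assert (A : Q' a <= Q (a [+] (t / s) [*] w) - t / s * Q w).
          { apply L1. exists (t / s). split; [|reflexivity].
            apply Rmult_le_pos; [exact Ht|]. left. now apply Rinv_0_lt_compat. }
          apply Rmult_le_compat_l with (r := s) in A; [|lra].
          replace (s * (Q (a [+] (t / s) [*] w) - t / s * Q w))
            with (s * Q (a [+] (t / s) [*] w) - t * Q w) in A by (field; lra).
          exact A. }
      assert (A := Hmin Q' SQ'). specialize (A ltac:(intros u; apply L1; exists 0; split; [lra|];
        replace (u [+] 0 [*] w) with u by vlin; ring) v).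
      assert (B : Q' v <= Q (v [+] 1 [*] w) - 1 * Q w) by (apply L1; exists 1; split; [lra|reflexivity]).
      rewrite b_scal1 in B. lra. }
  assert (Hadd : forall v w, Q (v [+] w) = Q v + Q w).
  { intros v w. apply Rle_antisym; [apply (proj1 SQ)|apply Hsup]. }
  assert (Hopp : forall v, Q (bopp v) = - Q v).
  { intros v. assert (A := Hadd v (bopp v)). rewrite b_addN, (sublinear0 SQ) in A. lra. }
  intros a v w. rewrite Hadd. f_equal.
  destruct (Rle_or_lt 0 a) as [Ha|Ha]; [now apply sublinear_scal_ge0|].
  replace (a [*] v) with (bopp ((- a) [*] v)) by vlin.
  rewrite Hopp, (proj2 SQ) by lra. ring.
Qed.

(** Zorn's lemma for the sublinear minorants of [P] in the reversed pointwise order: a chain has its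
    pointwise infimum as bound, which is finite because it stays above [- P (bopp v)]. *)
Theorem hahn_banach P : sublinear P -> exists L : V -> R, is_lin L /\ forall v, L v <= P v.
Proof.
  intros SP.
  set (T := { Q : V -> R | sublinear Q /\ forall v, Q v <= P v }).
  destruct (@zorn T (fun Q1 Q2 => forall v, proj1_sig Q2 v <= proj1_sig Q1 v)) as [[Q [SQ QP]] Hmin].
  - intros Q v. lra.
  - intros Q1 Q2 Q3 H1 H2 v. specialize (H1 v). specialize (H2 v). lra.
  - intros [Q1 H1] [Q2 H2] H3 H4. simpl in *.
    assert (Q1 = Q2) by (apply functional_extensionality; intros v; apply Rle_antisym; auto).
    subst. f_equal. apply proof_irrelevance.
  - intros A HA. destruct (classic (exists Q, A Q)) as [[Q0 HQ0]|HE].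
    2:{ exists (exist _ P (conj SP (fun v => Rle_refl _))). intros Q HQ. exfalso. eauto. }
    destruct (@real_glb_fun V (fun v r => exists Q, A Q /\ r = proj1_sig Q v)
                (fun v => - P (bopp v))) as [I [L1 L2]].
    + intros v. eauto.
    + intros v r [[Q [SQ QP]] [_ ->]]. simpl.
      assert (B := sublinear_opp v SQ). specialize (QP (bopp v)). lra.
    + assert (SI : sublinear I).
      { split.
        - intros v w. assert (I (v [+] w) - I w <= I v); [|lra].
          apply L2. intros r [Q1 [HQ1 ->]].
          assert (I (v [+] w) - proj1_sig Q1 v <= I w); [|lra].
          apply L2. intros r [Q2 [HQ2 ->]].
          (* Subadditivity of the infimum: of two members of a chain, the smaller one serves for
             both arguments. *)
          assert (HQ : exists Q, A Q /\ (forall u, proj1_sig Q u <= proj1_sig Q1 u) /\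
                                        (forall u, proj1_sig Q u <= proj1_sig Q2 u)).
          { destruct (HA Q1 Q2 HQ1 HQ2) as [H|H];
              [exists Q2|exists Q1]; repeat split; auto; intros; lra. }
          destruct HQ as [Q [HQ [U1 U2]]].
          assert (B : I (v [+] w) <= proj1_sig Q (v [+] w)) by (apply L1; eauto).
          assert (C := proj1 (proj1 (proj2_sig Q)) v w).
          specialize (U1 v). specialize (U2 w). lra.
        - apply pos_homogeneous_of_le. intros t v Ht. apply L2. intros r [Q [HQ ->]].
          rewrite (proj2 (proj1 (proj2_sig Q))) by exact Ht.
          apply Rmult_le_compat_l; [lra|]. apply L1. eauto. }
      assert (IP : forall v, I v <= P v).
      { intros v. apply Rle_trans with (proj1_sig Q0 v); [apply L1; eauto|apply (proj2_sig Q0)]. }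
      exists (exist _ I (conj SI IP)). intros Q HQ v. simpl. apply L1. eauto.
  - exists Q. split; [|exact QP]. apply sublinear_minimal_lin; [exact SQ|].
    intros Q' SQ' Hle v.
    assert (QP' : forall u, Q' u <= P u) by (intros u; assert (B := QP u); specialize (Hle u); lra).
    specialize (Hmin (exist _ Q' (conj SQ' QP')) Hle).
    apply (f_equal (@proj1_sig _ _)) in Hmin. simpl in Hmin. rewrite Hmin. lra.
Qed.

Definition cvx_graph (E : V -> R -> Prop) :=
  forall v a w b l, 0 <= l <= 1 -> E v a -> E w b ->
    E (l [*] v [+] (1 - l) [*] w) (l * a + (1 - l) * b).
Definition cvx_fun (j : V -> R) :=
  forall v w l, 0 <= l <= 1 -> j (l [*] v [+] (1 - l) [*] w) <= l * j v + (1 - l) * j w.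

(* [L] is a linear minorant of the directional derivative at the origin of the inf-convolution
   [v |-> inf (a + j (v + w) - m)]; this is Fenchel duality with the dual value attained. *)
Theorem fenchel_sandwich (E : V -> R -> Prop) (j : V -> R) (m : R) :
  (exists w a, E w a) -> cvx_graph E -> cvx_fun j -> (forall w a, E w a -> m <= a + j w) ->
  exists L : V -> R, is_lin L /\ forall u w a, E w a -> L u - L w <= a + j u - m.
Proof.
  intros [w0 [a0 E0]] CE Cj Hm.
  set (D := fun v r => exists t w a, 0 < t /\ E w a /\ r = (a + j (t [*] v [+] w) - m) / t).
  assert (Hadd : forall v1 r1 v2 r2, D v1 r1 -> D v2 r2 ->
    exists r, D (v1 [+] v2) r /\ r <= r1 + r2).
  { intros v1 r1 v2 r2 [t [w [a [Ht [Ea ->]]]]] [s [w' [a' [Hs [Ea' ->]]]]].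
    (* These weights give [l * t = (1 - l) * s = t'], so the convex combination is a point with step
       [t'] in direction [v1 [+] v2]. *)
    set (l := s / (t + s)).
    assert (Hl : 0 <= l <= 1).
    { unfold l. split.
      - apply Rmult_le_pos; [lra|]. left. apply Rinv_0_lt_compat. lra.
      - apply Rmult_le_reg_r with (t + s); [lra|]. unfold Rdiv.
        rewrite Rmult_assoc, Rinv_l by lra. lra. }
    set (t' := t * s / (t + s)).
    assert (Ht' : 0 < t').
    { unfold t'. apply Rdiv_lt_0_compat; [now apply Rmult_lt_0_compat|lra]. }
    set (w'' := l [*] w [+] (1 - l) [*] w').
    exists ((l * a + (1 - l) * a' + j (t' [*] (v1 [+] v2) [+] w'') - m) / t'). split.
    { exists t', w'', (l * a + (1 - l) * a'). repeat split; auto. now apply CE. }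
    assert (C := Cj (t [*] v1 [+] w) (s [*] v2 [+] w') l Hl).
    replace (l [*] (t [*] v1 [+] w) [+] (1 - l) [*] (s [*] v2 [+] w'))
      with (t' [*] (v1 [+] v2) [+] w'') in C by (unfold w'', t', l; vlin).
    apply Rmult_le_reg_r with t'; [exact Ht'|].
    unfold Rdiv at 1. rewrite Rmult_assoc, Rinv_l, Rmult_1_r by lra.
    replace (((a + j (t [*] v1 [+] w) - m) / t + (a' + j (s [*] v2 [+] w') - m) / s) * t')
      with (l * (a + j (t [*] v1 [+] w) - m) + (1 - l) * (a' + j (s [*] v2 [+] w') - m))
      by (unfold l, t'; field; lra).
    lra. }
  assert (Hzero : forall r, D bzero r -> 0 <= r).
  { intros r [t [w [a [Ht [Ea ->]]]]]. rewrite bscal_zero, badd0l.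
    apply Rmult_le_pos; [specialize (Hm w a Ea); lra|]. left. now apply Rinv_0_lt_compat. }
  assert (Hne : forall v, exists r, D v r).
  { intros v. exists ((a0 + j (1 [*] v [+] w0) - m) / 1), 1, w0, a0. repeat split; auto; lra. }
  destruct (@real_glb_fun V D (fun v => - ((a0 + j (1 [*] (bopp v) [+] w0) - m) / 1)))
    as [P [L1 L2]].
  - exact Hne.
  - intros v r Hr.
    destruct (Hadd v r (bopp v) ((a0 + j (1 [*] (bopp v) [+] w0) - m) / 1) Hr) as [r' [H1 H2]].
    + exists 1, w0, a0. repeat split; auto; lra.
    + rewrite b_addN in H1. apply Hzero in H1. lra.
  - assert (SP : sublinear P).
    { split.
      - intros v w. assert (P (v [+] w) - P w <= P v); [|lra].
        apply L2. intros r1 Hr1. assert (P (v [+] w) - r1 <= P w); [|lra].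
        apply L2. intros r2 Hr2. destruct (Hadd _ _ _ _ Hr1 Hr2) as [r [H1 H2]].
        apply L1 in H1. lra.
      - apply pos_homogeneous_of_le. intros s v Hs. apply L2. intros r [t [w [a [Ht [Ea ->]]]]].
        assert (B : P v <= (a + j ((t * s) [*] v [+] w) - m) / (t * s)).
        { apply L1. exists (t * s), w, a. repeat split; auto. now apply Rmult_lt_0_compat. }
        rewrite b_scalA.
        apply Rmult_le_compat_l with (r := s) in B; [|lra].
        replace (s * ((a + j ((t * s) [*] v [+] w) - m) / (t * s)))
          with ((a + j ((t * s) [*] v [+] w) - m) / t) in B by (field; lra). exact B. }
    destruct (hahn_banach SP) as [L [LL LP]]. exists L. split; [exact LL|].
    intros u w a Ea. rewrite <- (lin_sub LL).
    eapply Rle_trans; [apply LP|]. apply L1. exists 1, w, a. repeat split; [lra|exact Ea|].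
    replace (1 [*] (u [-] w) [+] w) with u by vlin. field.
Qed.
End Sublinear.

Lemma norm_cvx (V : Banach) (N : R) : 0 <= N -> cvx_fun (fun v : V => N * bnorm v).
Proof.
  intros HN v w l Hl. assert (A := bnorm_comb v w Hl). nra.
Qed.

Lemma sq_norm_cvx (V : Banach) (N : R) : 0 <= N -> cvx_fun (fun v : V => N * (bnorm v)²).
Proof.
  intros HN v w l Hl. assert (A := bnorm_comb v w Hl). unfold Rsqr.
  assert (B := b_norm_ge0 _ v). assert (C := b_norm_ge0 _ w).
  assert (D := b_norm_ge0 _ (l [*] v [+] (1 - l) [*] w)).
  assert (E : bnorm (l [*] v [+] (1 - l) [*] w) * bnorm (l [*] v [+] (1 - l) [*] w)
     <= (l * bnorm v + (1 - l) * bnorm w) * (l * bnorm v + (1 - l) * bnorm w))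
    by (apply Rmult_le_compat; lra).
  assert (F : (l * bnorm v + (1 - l) * bnorm w) * (l * bnorm v + (1 - l) * bnorm w)
     <= l * (bnorm v * bnorm v) + (1 - l) * (bnorm w * bnorm w)).
  { assert (0 <= l * (1 - l) * ((bnorm v - bnorm w) * (bnorm v - bnorm w))); [|lra].
    apply Rmult_le_pos; [nra|]. apply Rle_0_sqr. }
  nra.
Qed.

(** * Completeness arguments *)

Section Completeness.
Context {V : Banach}.

Lemma halving_tail (r : nat -> R) (x : nat -> V) :
  (forall k, bnorm (x (S k) [-] x k) <= r k / 2) -> (forall k, r (S k) <= r k / 2) ->
  forall n k, bnorm (x (n + k)%nat [-] x k) <= r k - r (n + k)%nat.
Proof.
  intros Hx Hr n k. induction n as [|n IH]; simpl.
  - rewrite bsub_self, bnorm0. lra.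
  - eapply Rle_trans; [apply bnorm_sub_tri with (y := x (n + k)%nat)|].
    specialize (Hx (n + k)%nat). specialize (Hr (n + k)%nat). lra.
Qed.

Lemma pow_half_small c eps : 0 < eps -> exists N, c * (/ 2) ^ N < eps.
Proof.
  intros He. destruct (pow_lt_1_zero (/ 2)) with (y := eps / (Rabs c + 1)) as [N HN].
  - rewrite Rabs_right; lra.
  - apply Rdiv_lt_0_compat; [exact He|]. assert (A := Rabs_pos c). lra.
  - exists N. specialize (HN N (le_n N)).
    assert (B : 0 < (/ 2) ^ N) by (apply pow_lt; lra).
    rewrite Rabs_right in HN by lra. assert (A := Rabs_pos c). assert (A' := Rle_abs c).
    apply Rmult_lt_compat_l with (r := Rabs c + 1) in HN; [|lra].
    replace ((Rabs c + 1) * (eps / (Rabs c + 1))) with eps in HN by (field; lra). nra.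
Qed.

(** [r k] is at once twice the bound on the next step and the bound on the whole tail, since the
    later steps add up to at most [r k / 2 + r k / 4 + ...]. *)
Lemma halving_limit (r : nat -> R) (x : nat -> V) :
  (forall k, 0 <= r k) ->
  (forall k, bnorm (x (S k) [-] x k) <= r k / 2) -> (forall k, r (S k) <= r k / 2) ->
  exists l, forall k, bnorm (x k [-] l) <= r k.
Proof.
  intros Hr0 Hx Hr.
  assert (Hpow : forall k, r k <= r O * (/ 2) ^ k).
  { induction k as [|k IH]; simpl; [lra|]. specialize (Hr k). lra. }
  assert (Htail := halving_tail r x Hx Hr).
  destruct (b_complete _ x) as [l Hl].
  - intros eps He. destruct (pow_half_small (r O) (eps := eps / 2)) as [N HN]; [lra|].
    exists N. intros m n Hm Hn. change (bnorm (x m [-] x n) < eps).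
    eapply Rle_lt_trans; [apply bnorm_sub_tri with (y := x N)|].
    rewrite (bnorm_sub_sym (x N)).
    assert (A := Htail (m - N)%nat N). assert (B := Htail (n - N)%nat N).
    replace (m - N + N)%nat with m in A by lia. replace (n - N + N)%nat with n in B by lia.
    assert (C := Hr0 m). assert (D := Hr0 n). specialize (Hpow N). lra.
  - exists l. intros k. apply Rnot_lt_le. intros C.
    destruct (Hl (bnorm (x k [-] l) - r k)) as [N HN]; [lra|].
    specialize (HN (N + k)%nat ltac:(lia)). change (bnorm (x (N + k)%nat [-] l) < bnorm (x k [-] l) - r k) in HN.
    assert (A := Htail N k). assert (B := bnorm_sub_tri (x k) (x (N + k)%nat) l).
    rewrite (bnorm_sub_sym (x k) (x (N + k)%nat)) in B. assert (D := Hr0 (N + k)%nat). lra.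
Qed.

Definition nclosure (D : V -> Prop) (x : V) :=
  forall eps, 0 < eps -> exists y, D y /\ bnorm (x [-] y) <= eps.

(** If every [F n] failed to be dense in every ball of [W], one could choose shrinking balls, the
    one of index [n + 1] missing [F n]; their limit would lie in [W] but in no [F n]. The version
    relative to a closed [W] is needed because the differences only fill a closed subspace of the
    dual. *)
Lemma baire (W : V -> Prop) (F : nat -> V -> Prop) :
  (exists w, W w) -> (forall w, nclosure W w -> W w) -> (forall w, W w -> exists n, F n w) ->
  exists n w0 r, W w0 /\ 0 < r /\ forall w, W w -> bnorm (w [-] w0) < r -> nclosure (F n) w.
Proof.
  intros [w00 Hw00] Wcl Hcov. apply NNPP. intros Hno.
  assert (Hstep : forall n w r, W w -> 0 < r -> exists w' r', W w' /\ 0 < r' /\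
    bnorm (w' [-] w) <= r / 2 /\ r' <= r / 2 /\ forall c, F n c -> r' < bnorm (w' [-] c)).
  { intros n w r Hw Hr. apply NNPP. intros H. apply Hno. exists n, w, (r / 2).
    split; [exact Hw|]. split; [lra|]. intros w' Hw' Hd eps He. apply NNPP. intros H'.
    apply H. exists w', (Rmin eps (r / 2)).
    assert (M1 := Rmin_l eps (r / 2)). assert (M2 := Rmin_r eps (r / 2)).
    repeat split; try lra; [exact Hw'|apply Rmin_pos; lra|].
    intros c Hc. apply Rnot_le_lt. intros H2. apply H'. exists c. split; [exact Hc|]. lra. }
  set (St := { p : V * R | W (fst p) /\ 0 < snd p }).
  assert (Hnext : forall n (s : St), exists s' : St,
    bnorm (fst (proj1_sig s') [-] fst (proj1_sig s)) <= snd (proj1_sig s) / 2 /\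
    snd (proj1_sig s') <= snd (proj1_sig s) / 2 /\
    forall c, F n c -> snd (proj1_sig s') < bnorm (fst (proj1_sig s') [-] c)).
  { intros n [[w r] [Hw Hr]]. destruct (Hstep n w r Hw Hr) as [w' [r' [H1 [H2 H3]]]].
    exists (exist _ (w', r') (conj H1 H2)). exact H3. }
  destruct (choice_fun _ (fun n => choice_fun _ (Hnext n))) as [next nextP].
  set (s := fix s n : St := match n with
    | O => exist _ (w00, 1) (conj Hw00 Rlt_0_1) | S n => next n (s n) end).
  assert (Hs : forall n, s (S n) = next n (s n)) by reflexivity. clearbody s.
  destruct (halving_limit (fun n => snd (proj1_sig (s n))) (fun n => fst (proj1_sig (s n))))
    as [l Hl].
  - intros k. left. apply (proj2 (proj2_sig (s k))).
  - intros k. rewrite Hs. apply nextP.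
  - intros k. rewrite Hs. apply nextP.
  - assert (Hpow : forall k, snd (proj1_sig (s k)) <= snd (proj1_sig (s O)) * (/ 2) ^ k).
    { induction k as [|k IH]; simpl; [lra|].
      assert (A := proj1 (proj2 (nextP k (s k)))). rewrite <- Hs in A. lra. }
    assert (Wl : W l).
    { apply Wcl. intros eps He.
      destruct (pow_half_small (snd (proj1_sig (s O))) He) as [N HN].
      exists (fst (proj1_sig (s N))). split; [apply (proj2_sig (s N))|].
      rewrite bnorm_sub_sym. specialize (Hl N). specialize (Hpow N). simpl in Hl. lra. }
    destruct (Hcov l Wl) as [n Hn].
    assert (A := proj2 (proj2 (nextP n (s n))) l Hn). rewrite <- Hs in A.
    specialize (Hl (S n)). simpl in Hl. lra.
Qed.
End Completeness.

(** * The Robinson-Ursescu theorem for closed convex relations *)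

Section RobinsonUrsescu.
Context {Y V : Banach}.
Variable G : Y -> V -> Prop.
Hypothesis Gcvx : forall y v y' v' l, 0 <= l <= 1 -> G y v -> G y' v' ->
  G (l [*] y [+] (1 - l) [*] y') (l [*] v [+] (1 - l) [*] v').
Hypothesis Gclosed : forall y v,
  (forall eps, 0 < eps -> exists y' v', G y' v' /\ bnorm (y [-] y') <= eps /\ bnorm (v [-] v') <= eps) ->
  G y v.

(** The iteration of the open mapping theorem: [w0] is the convex series of the [c k] with weights
    [(/ 2) ^ (S k)], where [c k] approximates the doubled residual of the previous stage. Starting
    from [2 [*] w0] explains the radius [rho / 2]. *)
Lemma absorb_approx (n rho : R) (W : V -> Prop) :
  0 <= n -> 0 < rho ->
  (forall a v w, W v -> W w -> W (a [*] v [+] w)) ->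
  (forall y v, G y v -> W v) ->
  (exists y, bnorm y <= n /\ G y bzero) ->
  (forall w, W w -> bnorm w < rho ->
     nclosure (fun v => exists y, bnorm y <= n /\ G y v) w) ->
  forall w, W w -> bnorm w < rho / 2 -> exists y, bnorm y <= n /\ G y w.
Proof.
  intros Hn Hrho Wlin GW [y0 [Hy0 G0]] Happ w0 Hw0 Hw0r.
  assert (Wscal : forall a v, W v -> W (a [*] v)).
  { intros a v Hv. replace (a [*] v) with ((a - 1) [*] v [+] v) by vlin. now apply Wlin. }
  set (St := { e : V | W e /\ bnorm e < rho }).
  assert (Hnext : forall e : St, exists q : Y * V * St,
     bnorm (fst (fst q)) <= n /\ G (fst (fst q)) (snd (fst q)) /\
     proj1_sig (snd q) = 2 [*] (proj1_sig e [-] snd (fst q))).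
  (* With error [rho / 3] the doubled residual has norm at most [2 rho / 3], so it remains in the
     ball. *)
  { intros [e [We He]]. destruct (Happ e We He (rho / 3)) as [c [[y [Hy Gy]] Hc]]; [lra|].
    assert (H : W (2 [*] (e [-] c)) /\ bnorm (2 [*] (e [-] c)) < rho).
    { split.
      - apply Wscal. replace (e [-] c) with ((-1) [*] c [+] e) by vlin.
        apply Wlin; [now apply (GW y)|exact We].
      - rewrite bnorm_pscal by lra. lra. }
    exists (y, c, exist (fun e => W e /\ bnorm e < rho) _ H). simpl. auto. }
  destruct (choice_fun _ Hnext) as [nx nxP].
  assert (He0 : W (2 [*] w0) /\ bnorm (2 [*] w0) < rho).
  { split; [now apply Wscal|]. rewrite bnorm_pscal by lra. lra. }
  set (s := fix s k : St := match k with O => exist (fun e => W e /\ bnorm e < rho) _ He0 | S k => snd (nx (s k)) end).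
  assert (Hs0 : proj1_sig (s O) = 2 [*] w0) by reflexivity.
  assert (HsS : forall k, s (S k) = snd (nx (s k))) by reflexivity.
  clearbody s.
  set (y := fun k => fst (fst (nx (s k)))). set (c := fun k => snd (fst (nx (s k)))).
  set (Yk := fix Yk k := match k with O => bzero | S k => Yk k [+] (/ 2) ^ (S k) [*] y k end).
  set (Vk := fix Vk k := match k with O => bzero | S k => Vk k [+] (/ 2) ^ (S k) [*] c k end).
  assert (HYS : forall k, Yk (S k) = Yk k [+] (/ 2) ^ (S k) [*] y k) by reflexivity.
  assert (HVS : forall k, Vk (S k) = Vk k [+] (/ 2) ^ (S k) [*] c k) by reflexivity.
  assert (HY0 : Yk O = bzero) by reflexivity. assert (HV0 : Vk O = bzero) by reflexivity.
  clearbody Yk Vk.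
  assert (Hinv : forall k, w0 = Vk k [+] ((/ 2) ^ (S k)) [*] proj1_sig (s k)).
  { induction k as [|k IH].
    - rewrite HV0, Hs0. simpl. vlin.
    - rewrite HVS, HsS, (proj2 (proj2 (nxP (s k)))). rewrite IH at 1. fold (c k).
      simpl. generalize ((/ 2) ^ k). intros t. vlin. }
  (* A partial sum has total weight [1 - (/ 2) ^ k]; the missing weight may go to any point of [G],
     and in the end it goes to [(y0, bzero)]. *)
  assert (HG : forall k y' c', G y' c' ->
     G (Yk k [+] (/ 2) ^ k [*] y') (Vk k [+] (/ 2) ^ k [*] c')).
  { induction k as [|k IH]; intros y' c' H'.
    - rewrite HY0, HV0. simpl. replace (bzero [+] 1 [*] y') with y' by vlin.
      now replace (bzero [+] 1 [*] c') with c' by vlin.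
    - rewrite HYS, HVS.
      assert (A : G (/ 2 [*] y k [+] (1 - / 2) [*] y') (/ 2 [*] c k [+] (1 - / 2) [*] c')).
      { apply Gcvx; [lra|apply (nxP (s k))|exact H']. }
      apply IH in A. simpl.
      match goal with |- G ?a ?b => match type of A with G ?a' ?b' =>
        replace a with a'; [replace b with b'|] end end; [exact A| |];
      generalize ((/ 2) ^ k); intros t; vlin. }
  assert (Hpos : forall k, 0 < (/ 2) ^ k) by (intros k; apply pow_lt; lra).
  destruct (halving_limit (fun k => n * (/ 2) ^ k) Yk) as [l Hl].
  - intros k. specialize (Hpos k). nra.
  - intros k. rewrite HYS.
    replace ((Yk k [+] (/ 2) ^ (S k) [*] y k) [-] Yk k) with ((/ 2) ^ (S k) [*] y k) by vlin.
    assert (A := Hpos (S k)). rewrite bnorm_pscal by lra. simpl in *.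
    assert (B := proj1 (nxP (s k))). fold (y k) in B. specialize (Hpos k). nra.
  - intros k. simpl. lra.
  - exists l. split.
    { assert (A := Hl O). rewrite HY0 in A. simpl in A.
      rewrite bnorm_sub_sym in A. replace (l [-] bzero) with l in A by vlin. lra. }
    apply Gclosed. intros eps He.
    destruct (pow_half_small (2 * n + rho) He) as [k Hk].
    exists (Yk k [+] (/ 2) ^ k [*] y0), (Vk k [+] (/ 2) ^ k [*] bzero).
    specialize (Hpos k). split; [now apply HG|]. split.
    + eapply Rle_trans; [apply bnorm_sub_tri with (y := Yk k)|].
      rewrite bnorm_sub_sym.
      replace (Yk k [-] (Yk k [+] (/ 2) ^ k [*] y0)) with (bopp ((/ 2) ^ k [*] y0)) by vlin.
      rewrite bnorm_opp, bnorm_pscal by lra. specialize (Hl k). simpl in Hl. nra.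
    + rewrite (Hinv k) at 1.
      replace ((Vk k [+] (/ 2) ^ S k [*] proj1_sig (s k)) [-] (Vk k [+] (/ 2) ^ k [*] bzero))
        with ((/ 2) ^ S k [*] proj1_sig (s k)) by vlin.
      assert (A := proj2 (proj2_sig (s k))). simpl in A.
      assert (B := b_norm_ge0 _ (proj1_sig (s k))).
      rewrite bnorm_pscal by (simpl; lra). simpl. nra.
Qed.

Theorem robinson_ursescu (W : V -> Prop) :
  (forall a v w, W v -> W w -> W (a [*] v [+] w)) ->
  (forall w, nclosure W w -> W w) ->
  (forall y v, G y v -> W v) ->
  (exists y, G y bzero) ->
  (forall w, W w -> exists delta, 0 < delta /\
     forall l, 0 <= l <= delta -> exists y, G y (l [*] w)) ->
  exists r K, 0 < r /\ forall w, W w -> bnorm w <= r -> exists y, bnorm y <= K /\ G y w.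
Proof.
  intros Wlin Wcl GW [y0 G0] Habs.
  assert (W0 : W bzero) by (now apply (GW y0)).
  assert (Wscal : forall a v, W v -> W (a [*] v)).
  { intros a v Hv. rewrite <- (b_add0 _ (a [*] v)). now apply Wlin. }
  set (m := fun n : nat => bnorm y0 + 1 + INR n).
  assert (Hm : forall n, 1 <= m n /\ bnorm y0 <= m n).
  { intros n. unfold m. assert (A := pos_INR n). assert (B := b_norm_ge0 _ y0). lra. }
  (* Scaling the argument down while enlarging the ball makes these sets convex, increasing in [n]
     and a cover of [W]. Monotonicity mixes in [(y0, bzero)], hence [m n] is at least [bnorm y0]. *)
  set (F := fun n w => exists y, bnorm y <= m n /\ G y (/ m n [*] w)).
  assert (Fmono : forall n n' w, (n <= n')%nat -> F n w -> F n' w).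
  { intros n n' w Hnn [y [Hy Gy]].
    assert (A : m n <= m n') by (unfold m; apply le_INR in Hnn; lra).
    destruct (Hm n) as [B1 B2]. destruct (Hm n') as [B1' B2'].
    set (l := m n / m n').
    assert (Hl : 0 <= l <= 1).
    { unfold l. split; [apply Rlt_le, Rdiv_lt_0_compat; lra|].
      apply Rmult_le_reg_r with (m n'); [lra|].
      unfold Rdiv. rewrite Rmult_assoc, Rinv_l by lra. lra. }
    exists (l [*] y [+] (1 - l) [*] y0). split.
    - eapply Rle_trans; [now apply bnorm_comb|]. nra.
    - replace (/ m n' [*] w) with (l [*] (/ m n [*] w) [+] (1 - l) [*] bzero).
      + now apply Gcvx.
      + unfold l. vlin. }
  assert (Fcvx : forall n v w l, 0 <= l <= 1 -> F n v -> F n w -> F n (l [*] v [+] (1 - l) [*] w)).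
  { intros n v w l Hl [y [Hy Gy]] [y' [Hy' Gy']].
    exists (l [*] y [+] (1 - l) [*] y'). split.
    - eapply Rle_trans; [now apply bnorm_comb|]. nra.
    - replace (/ m n [*] (l [*] v [+] (1 - l) [*] w))
        with (l [*] (/ m n [*] v) [+] (1 - l) [*] (/ m n [*] w)) by vlin.
      now apply Gcvx. }
  assert (Fcov : forall w, W w -> exists n, F n w).
  { intros w Hw. destruct (Habs w Hw) as [d [Hd H]].
    destruct (INR_unbounded (/ d)) as [n1 Hn1].
    assert (P1 : / m n1 <= d).
    { destruct (Hm n1) as [B1 B2]. rewrite <- (Rinv_inv d).
      apply Rinv_le_contravar; [now apply Rinv_0_lt_compat|].
      unfold m. assert (B := b_norm_ge0 _ y0). lra. }
    assert (P2 : 0 < / m n1) by (apply Rinv_0_lt_compat; destruct (Hm n1); lra).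
    destruct (H (/ m n1)) as [y Gy]; [lra|].
    destruct (INR_unbounded (bnorm y)) as [n2 Hn2].
    set (l := m n1 / m (n1 + n2)%nat).
    destruct (Hm n1) as [B1 B2]. destruct (Hm (n1 + n2)%nat) as [B1' B2'].
    assert (A : m n1 <= m (n1 + n2)%nat) by (unfold m; rewrite plus_INR; assert (C := pos_INR n2); lra).
    assert (Hl : 0 <= l <= 1).
    { unfold l. split; [apply Rlt_le, Rdiv_lt_0_compat; lra|].
      apply Rmult_le_reg_r with (m (n1 + n2)%nat); [lra|].
      unfold Rdiv. rewrite Rmult_assoc, Rinv_l by lra. lra. }
    exists (n1 + n2)%nat, (l [*] y [+] (1 - l) [*] y0). split.
    - eapply Rle_trans; [now apply bnorm_comb|].
      assert (bnorm y <= m (n1 + n2)%nat); [|nra].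
      unfold m. rewrite plus_INR. assert (C := pos_INR n1). assert (D := b_norm_ge0 _ y0). lra.
    - replace (/ m (n1 + n2)%nat [*] w) with (l [*] (/ m n1 [*] w) [+] (1 - l) [*] bzero).
      + now apply Gcvx.
      + unfold l. vlin. }
  destruct (@baire V W F) as [n [w0 [r [Hw0 [Hr Hball]]]]]; [eauto|exact Wcl|exact Fcov|].
  (* The dense ball sits around [w0]; averaging with the point [bopp w0] of some [F n'] moves it to
     the origin and halves its radius. *)
  destruct (Fcov (bopp w0)) as [n' Hn'].
  { rewrite bopp_scal. now apply Wscal. }
  set (N := (n + n')%nat).
  assert (FN : forall e, W e -> bnorm e < r / 2 -> nclosure (F N) e).
  { intros e We He eps Heps.
    destruct (Hball (w0 [+] 2 [*] e)) with (eps := eps) as [c [Hc Hd]].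
    - rewrite b_addC. now apply Wlin.
    - replace ((w0 [+] 2 [*] e) [-] w0) with (2 [*] e) by vlin. rewrite bnorm_pscal; lra.
    - exact Heps.
    - exists (/ 2 [*] c [+] (1 - / 2) [*] bopp w0). split.
      + apply Fcvx; [lra| |]; (eapply Fmono; [|eassumption]); unfold N; lia.
      + replace (e [-] (/ 2 [*] c [+] (1 - / 2) [*] bopp w0))
          with (/ 2 [*] ((w0 [+] 2 [*] e) [-] c)) by vlin.
        rewrite bnorm_pscal by lra. assert (A := b_norm_ge0 _ ((w0 [+] 2 [*] e) [-] c)). lra. }
  destruct (Hm N) as [B1 B2].
  assert (P := Rinv_0_lt_compat (m N) ltac:(lra)).
  set (rho := r / 2 * / m N).
  assert (Hrho : 0 < rho) by (unfold rho; nra).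
  exists (rho / 4), (m N). split; [lra|]. intros w Hw Hwr.
  apply (@absorb_approx (m N) rho W); try assumption; try lra; [eauto|].
  intros e We He eps Heps.
  destruct (FN (m N [*] e)) with (eps := m N * eps) as [c [[y [Hy Gy]] Hc]].
  - now apply Wscal.
  - rewrite bnorm_pscal by lra. apply Rmult_lt_compat_l with (r := m N) in He; [|lra].
    unfold rho in He. replace (m N * (r / 2 * / m N)) with (r / 2) in He by (field; lra). exact He.
  - nra.
  - exists (/ m N [*] c). split; [eauto|].
    replace (e [-] / m N [*] c) with (/ m N [*] ((m N [*] e) [-] c)) by vlin.
    rewrite bnorm_pscal by lra.
    apply Rmult_le_compat_l with (r := / m N) in Hc; [|lra].
    rewrite <- Rmult_assoc, Rinv_l, Rmult_1_l in Hc by lra. exact Hc.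
Qed.
End RobinsonUrsescu.

#[warnings="-projection-no-head-constant"] Canonical dualB.
#[warnings="-projection-no-head-constant"] Canonical prodB.
#[warnings="-projection-no-head-constant"] Canonical RB.

(** * Dual pairings *)

Lemma neg_abs_le r : - Rabs r <= r.
Proof. assert (A := Rle_abs (- r)). rewrite Rabs_Ropp in A. lra. Qed.

Section Pairing.
Context {X : Banach}.
Implicit Types (x y c : X) (f g : dual X).

Lemma deval_add f g x : dapp (f [+] g) x = f x + g x.
Proof. simpl. ring. Qed.
Lemma deval_scal a f x : dapp (a [*] f) x = a * f x.
Proof. simpl. ring. Qed.
Lemma deval_opp f x : dapp (bopp f) x = - f x.
Proof. simpl. ring. Qed.
Lemma deval_sub f g x : dapp (f [-] g) x = f x - g x.
Proof. simpl. ring. Qed.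

Lemma dcombE a f b g : dcomb a f b g = a [*] f [+] b [*] g.
Proof. dual_ring. Qed.
Lemma dsubE f g : dsub f g = f [-] g.
Proof. dual_ring. Qed.

Lemma dual_bound f x : Rabs (f x) <= bnorm f * bnorm x.
Proof. apply dnorm_bound. Qed.

Lemma dual_bound_le f x : f x <= bnorm f * bnorm x.
Proof. eapply Rle_trans; [apply Rle_abs|apply dual_bound]. Qed.

Lemma dual_bound_ge f x : - (bnorm f * bnorm x) <= f x.
Proof. assert (A := dual_bound f x). assert (B := neg_abs_le (f x)). lra. Qed.

Lemma dnorm_attain f d : 0 < d -> exists x, bnorm x <= 1 /\ bnorm f - d < f x.
Proof.
  intros Hd. apply NNPP. intros H.
  assert (A : dnorm f <= dnorm f - d); [|lra].
  apply (proj2 (dnorm_lub f)). intros r [x [Hx ->]].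
  apply Rabs_le. split; apply Rnot_lt_le; intros C; apply H.
  - exists (bopp x). rewrite bnorm_opp, (lin_opp (dual_lin f)). split; [exact Hx|]. simpl. lra.
  - exists x. split; [exact Hx|]. simpl. lra.
Qed.

(** The conjugate of [mu / 2 |.|^2] is [|.|^2 / (2 mu)]. A nearly norming vector scaled by
    [bnorm f / mu] comes within [eta] of the supremum. *)
Lemma half_sq_conj f mu eta : 0 < mu -> 0 < eta ->
  exists e, / (2 * mu) * (bnorm f)² - eta <= f e - mu / 2 * (bnorm e)².
Proof.
  intros Hmu He. assert (Hf := b_norm_ge0 _ f). set (n := bnorm f) in *.
  set (d := eta * mu / (n + 1)).
  assert (Hd : 0 < d) by (unfold d; apply Rdiv_lt_0_compat; [now apply Rmult_lt_0_compat|lra]).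
  destruct (dnorm_attain f Hd) as [x [Hx Hfx]]. fold n in Hfx.
  assert (Hm : 0 < / mu) by now apply Rinv_0_lt_compat.
  exists ((n / mu) [*] x). rewrite (lin_scal (dual_lin f)).
  assert (Hnm : 0 <= n / mu) by (apply Rmult_le_pos; lra).
  rewrite bnorm_pscal, Rsqr_mult by exact Hnm.
  assert (Hx2 : (bnorm x)² <= 1).
  { assert (B := b_norm_ge0 _ x). unfold Rsqr. nra. }
  assert (A : n / mu * f x >= n / mu * (n - d)).
  { apply Rle_ge, Rmult_le_compat_l; lra. }
  assert (B : mu / 2 * ((n / mu)² * (bnorm x)²) <= mu / 2 * ((n / mu)² * 1)).
  { apply Rmult_le_compat_l; [lra|]. apply Rmult_le_compat_l; [apply Rle_0_sqr|exact Hx2]. }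
  assert (C : n / mu * d <= eta).
  { unfold d. replace (n / mu * (eta * mu / (n + 1))) with (eta * (n / (n + 1))) by (field; lra).
    assert (n / (n + 1) <= 1); [|nra].
    apply Rmult_le_reg_r with (n + 1); [lra|]. unfold Rdiv.
    rewrite Rmult_assoc, Rinv_l by lra. lra. }
  assert (D : n / mu * (n - d) - mu / 2 * ((n / mu)² * 1) = / (2 * mu) * n² - n / mu * d).
  { unfold Rsqr. field. lra. }
  lra.
Qed.

Lemma eval_is_dual x : is_dual (fun f : dual X => f x).
Proof.
  split.
  - intros a f g. now rewrite deval_add, deval_scal.
  - exists (bnorm x). intros f. rewrite Rmult_comm. apply dual_bound.
Qed.

Lemma pairing_close x y f g r : 0 <= r ->
  bnorm (y [-] x) <= r -> bnorm (g [-] f) <= r ->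
  Rabs (g y - f x) <= r * (bnorm x + bnorm f + r).
Proof.
  intros Hr H1 H2.
  assert (E : g y - f x = dapp (g [-] f) (y [-] x) + dapp (g [-] f) x + f (y [-] x)).
  { rewrite !deval_sub, !(lin_sub (dual_lin _)). ring. }
  rewrite E.
  assert (A := dual_bound (g [-] f) (y [-] x)). assert (B := dual_bound (g [-] f) x).
  assert (C := dual_bound f (y [-] x)).
  assert (T1 := Rabs_triang (dapp (g [-] f) (y [-] x) + dapp (g [-] f) x) (f (y [-] x))).
  assert (T2 := Rabs_triang (dapp (g [-] f) (y [-] x)) (dapp (g [-] f) x)).
  assert (P1 := b_norm_ge0 _ (g [-] f)). assert (P2 := b_norm_ge0 _ (y [-] x)).
  assert (P3 := b_norm_ge0 _ x). assert (P4 := b_norm_ge0 _ f).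
  assert (bnorm (g [-] f) * bnorm (y [-] x) <= r * r) by (apply Rmult_le_compat; lra).
  assert (bnorm (g [-] f) * bnorm x <= r * bnorm x) by (apply Rmult_le_compat_r; lra).
  assert (bnorm f * bnorm (y [-] x) <= bnorm f * r) by (apply Rmult_le_compat_l; lra).
  lra.
Qed.

(* For convex [C] this says that [p] lies in the weak-star closure of [C] in the bidual. *)
Definition pdense (p : dual X -> R) (C : X -> Prop) :=
  forall f eta, 0 < eta -> exists c, C c /\ f c <= p f + eta.

Definition cvx_set (C : X -> Prop) :=
  forall x y l, 0 <= l <= 1 -> C x -> C y -> C (l [*] x [+] (1 - l) [*] y).

(** The separated form of Goldstine's theorem, attested by [- K] times a nearly norming vector. *)
Lemma ball_pdense (p : dual X -> R) K : 0 <= K -> (forall f, Rabs (p f) <= K * bnorm f) ->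
  pdense p (fun c => bnorm c <= K).
Proof.
  intros HK Hp f eta He.
  destruct (@dnorm_attain f (eta / (K + 1))) as [x [Hx Hfx]]; [apply Rdiv_lt_0_compat; lra|].
  exists ((- K) [*] x). split.
  - rewrite b_norm_scal, Rabs_Ropp, Rabs_right by lra. assert (B := b_norm_ge0 _ x). nra.
  - rewrite (lin_scal (dual_lin f)). specialize (Hp f).
    assert (A := neg_abs_le (p f)).
    assert (K * (bnorm f - eta / (K + 1)) <= K * f x) by (apply Rmult_le_compat_l; lra).
    assert (K * (eta / (K + 1)) <= eta); [|lra].
    replace (K * (eta / (K + 1))) with (eta * (K / (K + 1))) by (field; lra).
    assert (K / (K + 1) <= 1); [|nra].
    apply Rmult_le_reg_r with (K + 1); [lra|]. unfold Rdiv.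
    rewrite Rmult_assoc, Rinv_l by lra. lra.
Qed.

Lemma slab_cvx (C : X -> Prop) g t e : cvx_set C -> cvx_set (fun c => C c /\ Rabs (g c - t) <= e).
Proof.
  intros HC x y l Hl [Cx Hx] [Cy Hy]. split; [now apply HC|].
  rewrite (lin_add (dual_lin g)), !(lin_scal (dual_lin g)).
  replace (l * g x + (1 - l) * g y - t) with (l * (g x - t) + (1 - l) * (g y - t)) by ring.
  eapply Rle_trans; [apply Rabs_triang|]. rewrite !Rabs_mult, !(Rabs_right l), (Rabs_right (1 - l)) by lra.
  nra.
Qed.

(** Map [C] to the plane by [(g c - p g, f c - p f)]. If the slab failed at [f], the convex image
    would keep distance [Rmin e eta] from the origin, and the separating coefficients [al], [be]
    would contradict the density of [C] at [al [*] g [+] be [*] f]. *)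
Lemma slab_pdense (p : dual X -> R) (C : X -> Prop) g e : is_dual p -> cvx_set C -> 0 < e ->
  pdense p C -> pdense p (fun c => C c /\ Rabs (g c - p g) <= e).
Proof.
  intros [Lp _] HC He HpC f eta Heta. apply NNPP. intros Hno.
  set (m := Rmin e eta). assert (Hm : 0 < m) by (now apply Rmin_pos).
  assert (M1 := Rmin_l e eta). assert (M2 := Rmin_r e eta). fold m in M1, M2.
  destruct (@fenchel_sandwich (prodB RB RB)
    (fun w a => exists c, C c /\ w = (g c - p g, f c - p f) /\ a = 0)
    (fun w => 1 * bnorm w) m) as [L [LL HL]].
  - destruct (HpC f eta Heta) as [c [Hc _]]. do 2 eexists. exists c. eauto.
  - intros v a w b l Hl [c [Hc [-> ->]]] [c' [Hc' [-> ->]]].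
    exists (l [*] c [+] (1 - l) [*] c'). split; [now apply HC|]. split; [|ring].
    simpl. rewrite !(lin_add (dual_lin _)), !(lin_scal (dual_lin _)). f_equal; ring.
  - apply norm_cvx. lra.
  - intros w a [c [Hc [-> ->]]]. simpl.
    destruct (Rle_or_lt (Rabs (g c - p g)) e) as [H1|H1].
    + destruct (Rle_or_lt (f c) (p f + eta)) as [H2|H2].
      * exfalso. apply Hno. exists c. auto.
      * assert (A := Rabs_pos (g c - p g)). assert (B := Rle_abs (f c - p f)). lra.
    + assert (A := Rabs_pos (f c - p f)). lra.
  - set (al := L (1, 0)). set (be := L (0, 1)).
    destruct (HpC (al [*] g [+] be [*] f) (m / 2)) as [c [Hc HG]]; [lra|].
    assert (A := HL bzero _ 0 (ex_intro _ c (conj Hc (conj eq_refl eq_refl)))).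
    rewrite (lin_zero LL), bnorm0 in A.
    replace ((g c - p g, f c - p f) : prodB RB RB)
      with ((g c - p g) [*] (1, 0) [+] (f c - p f) [*] (0, 1)) in A
      by (simpl; f_equal; ring).
    rewrite (lin_add LL), !(lin_scal LL) in A. fold al be in A.
    rewrite (lin_add Lp), !(lin_scal Lp), deval_add, !deval_scal in HG. lra.
Qed.

(** Start from the ball and cut one slab for each functional in [F]. These sets give convex access
    to the basic weak-star neighbourhoods of [p]. *)
Lemma weak_nbhd_pdense (p : dual X -> R) K e (F : list (dual X)) : is_dual p -> 0 <= K -> 0 < e ->
  (forall f, Rabs (p f) <= K * bnorm f) ->
  let C := fun c => bnorm c <= K /\ forall g, In g F -> Rabs (g c - p g) <= e in
  cvx_set C /\ pdense p C.
Proof.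
  intros Dp HK He Hp. simpl. induction F as [|g F [IH1 IH2]].
  - split.
    + intros x y l Hl [Hx _] [Hy _]. split; [|intros g []].
      eapply Rle_trans; [now apply bnorm_comb|]. nra.
    + intros f eta Heta. destruct (@ball_pdense p K HK Hp f eta Heta) as [c [Hc Hf]].
      exists c. split; [split; [exact Hc|intros g []]|exact Hf].
  - assert (A := @slab_cvx _ g (p g) e IH1). assert (B := @slab_pdense p _ g e Dp IH1 He IH2).
    split.
    + intros x y l Hl [Hx Hx'] [Hy Hy'].
      destruct (A x y l Hl) as [[H1 H2] H3].
      * split; [split; [exact Hx|]|]; [intros h Hh|]; apply Hx'; simpl; auto.
      * split; [split; [exact Hy|]|]; [intros h Hh|]; apply Hy'; simpl; auto.
      * split; [exact H1|]. intros h [<-|Hh]; auto.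
    + intros f eta Heta. destruct (B f eta Heta) as [c [[[H1 H2] H3] H4]].
      exists c. split; [|exact H4]. split; [exact H1|]. intros h [<-|Hh]; auto.
Qed.
End Pairing.

(** * Convex sets representing maximal monotone operators of type (D) *)

Section Represented.
Context {X : Banach}.

(** A function [h] with infinite values is encoded by a relation: [E x f a] stands for
    [h (x, f) <= a], or merely for a point of a convex set. Closures, convex hulls and infimal
    convolutions then need no extended arithmetic. *)
Definition ecvx (E : X -> dual X -> R -> Prop) :=
  forall x f a y g b l, 0 <= l <= 1 -> E x f a -> E y g b ->
    E (l [*] x [+] (1 - l) [*] y) (l [*] f [+] (1 - l) [*] g) (l * a + (1 - l) * b).
Definition eclosed (E : X -> dual X -> R -> Prop) :=
  forall x f a, (forall eps, 0 < eps -> exists y g b, E y g b /\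
    bnorm (x [-] y) <= eps /\ bnorm (f [-] g) <= eps /\ Rabs (a - b) <= eps) -> E x f a.
Definition eabove (E : X -> dual X -> R -> Prop) := forall x f a, E x f a -> f x <= a.
(** The inequality [h^* >= c], with the supremum spelled out by near-attainment. An element of the
    bidual is a function that is [is_dual] on [dualB X]. *)
Definition estrong (E : X -> dual X -> R -> Prop) :=
  forall f (p : dual X -> R) eps, is_dual p -> 0 < eps ->
    exists x g a, E x g a /\ p f - eps < f x + p g - a.

(** If the infimum were at least [eps], the sandwich functional would split into [(f', p')]. Testing
    it at [s = bopp f'] and at a near-maximizer [e] of [f' e - mu / 2 |e|^2] cancels the quadratic
    terms; strength at [(f0 - f', p - p')] and density of [C] at [bopp f'] then contradict the
    gap. *)
Lemma strong_approx_min (E : X -> dual X -> R -> Prop) (p : dual X -> R) (f0 : dual X) (C : X -> Prop) mu eps :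
  ecvx E -> estrong E -> is_dual p -> cvx_set C -> pdense p C -> 0 < mu -> 0 < eps ->
  exists y g a c, E y g a /\ C c /\
    a - f0 y - p g + p f0 + (mu / 2 * (bnorm (y [-] c))² + / (2 * mu) * (bnorm (g [-] f0))²) < eps.
Proof.
  intros CE SE Dp CC pC Hmu He. apply NNPP. intros Hno.
  assert (Hmu2 : 0 < / (2 * mu)) by (apply Rinv_0_lt_compat; lra).
  assert (Lp := proj1 Dp).
  set (j := fun w : prodB X (dualB X) => mu / 2 * (bnorm (fst w))² + / (2 * mu) * (bnorm (snd w))²).
  destruct (@fenchel_sandwich (prodB X (dualB X))
    (fun w b => exists y g a c, E y g a /\ C c /\ w = (y [-] c, g [-] f0) /\
                                b = a - f0 y - p g + p f0) j eps) as [L [LL HL]].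
  - destruct (SE f0 p 1 Dp Rlt_0_1) as [y [g [a [Ea _]]]].
    destruct (pC f0 1 Rlt_0_1) as [c [Hc _]]. do 2 eexists. exists y, g, a, c. eauto.
  - intros v r w s l Hl [y [g [a [c [Ea [Hc [-> ->]]]]]]] [y' [g' [a' [c' [Ea' [Hc' [-> ->]]]]]]].
    exists (l [*] y [+] (1 - l) [*] y'), (l [*] g [+] (1 - l) [*] g'), (l * a + (1 - l) * a'),
      (l [*] c [+] (1 - l) [*] c').
    split; [now apply CE|]. split; [now apply CC|]. split.
    + change ((l [*] (y [-] c) [+] (1 - l) [*] (y' [-] c'),
               l [*] (g [-] f0) [+] (1 - l) [*] (g' [-] f0)) =
              ((l [*] y [+] (1 - l) [*] y') [-] (l [*] c [+] (1 - l) [*] c'),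
               (l [*] g [+] (1 - l) [*] g') [-] f0)).
      f_equal; [vlin|]. dual_ring.
    + rewrite (lin_add (dual_lin f0)), !(lin_scal (dual_lin f0)), (lin_add Lp), !(lin_scal Lp). ring.
  - intros v w l Hl. unfold j.
    assert (A := @sq_norm_cvx X (mu / 2) ltac:(lra) (fst v) (fst w) l Hl).
    assert (B := @sq_norm_cvx (dualB X) (/ (2 * mu)) ltac:(lra) (snd v) (snd w) l Hl).
    simpl in *. lra.
  - intros w b [y [g [a [c [Ea [Hc [-> ->]]]]]]]. apply Rnot_lt_le. intros H.
    apply Hno. exists y, g, a, c. split; [exact Ea|]. split; [exact Hc|]. exact H.
  - assert (Lpair : forall e s, L (e, s) = L (e, bzero) + L (bzero, s)).
    { intros e s. rewrite <- (lin_add LL). f_equal. simpl. f_equal; [vlin|].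
      dual_ring. }
    (* [j] is bounded on the unit ball, so [L] is bounded above there and both components are
       continuous. *)
    assert (Lb : exists K, forall u, bnorm u <= 1 -> L u <= K).
    { destruct (SE f0 p 1 Dp Rlt_0_1) as [y [g [a [Ea _]]]].
      destruct (pC f0 1 Rlt_0_1) as [c [Hc _]].
      exists (L (y [-] c, g [-] f0) + (a - f0 y - p g + p f0) + (mu / 2 + / (2 * mu)) - eps).
      intros [e s] Hu. assert (A := HL (e, s) (y [-] c, g [-] f0) (a - f0 y - p g + p f0)).
      assert (B : L (e, s) - L (y [-] c, g [-] f0) <= a - f0 y - p g + p f0 + j (e, s) - eps).
      { apply A. exists y, g, a, c. auto. }
      unfold j in B. cbn [fst snd] in B. change (bnorm e + bnorm s <= 1) in Hu.
      assert (P1 := b_norm_ge0 _ e). assert (P2 := b_norm_ge0 _ s).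
      assert (Q1 : (bnorm e)² <= 1) by (unfold Rsqr; nra).
      assert (Q2 : (bnorm s)² <= 1) by (unfold Rsqr; nra).
      assert (mu / 2 * (bnorm e)² <= mu / 2 * 1) by (apply Rmult_le_compat_l; lra).
      assert (/ (2 * mu) * (bnorm s)² <= / (2 * mu) * 1) by (apply Rmult_le_compat_l; lra).
      lra. }
    destruct Lb as [K HK].
    assert (D1 : is_dual (fun e : X => L (e, bzero))).
    { apply (@lin_bounded_dual X) with K.
      - intros a x y. rewrite <- LL. f_equal. simpl. f_equal. dual_ring.
      - intros x Hx. apply HK. change (bnorm x + bnorm (@bzero (dualB X)) <= 1). rewrite bnorm0. lra. }
    assert (D2 : is_dual (fun s : dual X => L (bzero, s))).
    { apply (@lin_bounded_dual (dualB X)) with K.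
      - intros a x y. rewrite <- LL. f_equal. simpl. f_equal. vlin.
      - intros x Hx. apply HK. change (bnorm (@bzero X) + bnorm x <= 1). rewrite bnorm0. lra. }
    set (f' := exist _ _ D1 : dual X). set (p' := fun s : dual X => L (bzero, s)).
    assert (Lp' : is_lin p') by apply D2.
    assert (LE : forall e s, L (e, s) = f' e + p' s) by exact Lpair.
    (* Three errors [eta] are spent, by the conjugate, by strength and by density; a quarter of
       [eps] remains for the contradiction. *)
    clearbody f'. set (eta := eps / 4).
    assert (Heta : 0 < eta) by (unfold eta; lra).
    destruct (half_sq_conj f' Hmu Heta) as [e He'].
    assert (Dq := is_dual_comb 1 (-1) Dp D2).
    destruct (SE (f0 [-] f') _ eta Dq Heta) as [y [g [a [Ea Hy]]]].
    destruct (pC (bopp f') eta Heta) as [c [Hc Hfc]].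
    assert (A := HL (e, bopp f') (y [-] c, g [-] f0) (a - f0 y - p g + p f0)
                  (ex_intro _ y (ex_intro _ g (ex_intro _ a (ex_intro _ c
                    (conj Ea (conj Hc (conj eq_refl eq_refl)))))))).
    unfold j in A. cbn [fst snd] in A.
    fold (p' (f0 [-] f')) in Hy. fold (p' g) in Hy.
    rewrite !LE, !(lin_sub Lp'), (lin_opp Lp'), (lin_sub (dual_lin f')), bnorm_opp in A.
    rewrite (lin_sub Lp), (lin_sub Lp'), deval_sub in Hy.
    rewrite (lin_opp Lp), deval_opp in Hfc. unfold eta in *. lra.
Qed.
End Represented.

(** * Contact sets: the Brondsted-Rockafellar property, type (NI) and approximation of points of
    Gossez's closure *)

Section RepresentedOperator.
Context {X : Banach}.
Variable E : X -> dual X -> R -> Prop.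
Hypothesis Ecvx : ecvx E.
Hypothesis Eclosed : eclosed E.
Hypothesis Eabove : eabove E.
Hypothesis Estrong : estrong E.

(** Four times the inequality [eabove] at the midpoint. *)
Lemma represented_monotone x f y g : E x f (f x) -> E y g (g y) -> 0 <= f x - g x - f y + g y.
Proof.
  intros H1 H2. assert (A := Eabove (Ecvx (l := / 2) ltac:(lra) H1 H2)).
  rewrite deval_add, !deval_scal, !(lin_add (dual_lin _)), !(lin_scal (dual_lin _)) in A. lra.
Qed.

Lemma represented_closed x (f : dual X) :
  (forall r, 0 < r -> exists y (g : dual X) b, E y g b /\ bnorm (y [-] x) <= r /\ bnorm (g [-] f) <= r /\
     b - g y <= r) -> E x f (f x).
Proof.
  intros H. apply Eclosed. intros eps He.
  assert (Px := b_norm_ge0 _ x). assert (Pf := b_norm_ge0 _ f).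
  set (K := bnorm x + bnorm f + 2).
  set (r := Rmin 1 (eps / K)).
  assert (Hr : 0 < r) by (apply Rmin_pos; [lra|apply Rdiv_lt_0_compat; unfold K; lra]).
  assert (M1 := Rmin_l 1 (eps / K)). assert (M2 := Rmin_r 1 (eps / K)). fold r in M1, M2.
  assert (M3 : r * K <= eps).
  { apply Rmult_le_compat_r with (r := K) in M2; [|unfold K; lra].
    unfold Rdiv in M2. rewrite Rmult_assoc, Rinv_l in M2 by (unfold K; lra). lra. }
  unfold K in M3.
  destruct (H r Hr) as [y [g [b [Hb [H1 [H2 H3]]]]]]. exists y, g, b.
  split; [exact Hb|]. rewrite (bnorm_sub_sym x), (bnorm_sub_sym f).
  assert (A := pairing_close x y f g (Rlt_le _ _ Hr) H1 H2). assert (B := Eabove Hb).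
  assert (T := Rabs_triang (b - g y) (g y - f x)).
  replace (b - g y + (g y - f x)) with (b - f x) in T by ring.
  rewrite (Rabs_right (b - g y)) in T by lra. rewrite (Rabs_minus_sym (f x)).
  assert (r * (bnorm x + bnorm f + r) <= r * (bnorm x + bnorm f + 1)) by (apply Rmult_le_compat_l; lra).
  split; [|split]; nra.
Qed.

(** With [p] the evaluation at [x0] and [C] the singleton, the linear part is
    [(a - g y) + (g - f0) (y - x0)]. The quadratic terms absorb the product, so the new gap is below
    the tolerance. *)
Lemma bronsted_rockafellar_step x0 (f0 : dual X) a0 d : 0 < d -> E x0 f0 a0 -> a0 - f0 x0 <= d² ->
  exists x1 (f1 : dual X) a1, E x1 f1 a1 /\ a1 - f1 x1 <= (d / 2)² /\
    bnorm (x1 [-] x0) <= 3 * d /\ bnorm (f1 [-] f0) <= 3 * d.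
Proof.
  intros Hd E0 H0.
  destruct (@strong_approx_min X E (fun f => f x0) f0 (eq x0) 1 ((d / 2)²) Ecvx Estrong)
    as [y [g [a [c [Ea [<- H]]]]]].
  - apply eval_is_dual.
  - intros u v l Hl <- <-. vlin.
  - intros f eta He. exists x0. split; [reflexivity|lra].
  - lra.
  - apply Rsqr_pos_lt. lra.
  - exists y, g, a. split; [exact Ea|].
    assert (A := Eabove (Ecvx (l := / 2) ltac:(lra) E0 Ea)).
    rewrite deval_add, !deval_scal, !(lin_add (dual_lin _)), !(lin_scal (dual_lin _)) in A.
    assert (B := dual_bound_ge (g [-] f0) (y [-] x0)).
    rewrite deval_sub, !(lin_sub (dual_lin _)) in B.
    assert (C := Eabove Ea). unfold Rsqr in *.
    assert (P1 := b_norm_ge0 _ (y [-] x0)). assert (P2 := b_norm_ge0 _ (g [-] f0)).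
    revert P1 P2 B H. generalize (bnorm (y [-] x0)), (bnorm (g [-] f0)). intros s t P1 P2 B H.
    assert (Q : 0 <= (s - t) * (s - t)) by apply Rle_0_sqr.
    (* The midpoint inequality bounds the linear part below by [- (d² / 4 + 2 d²)], so
       [s * s + t * t] is at most [5 d²]. *)
    assert (H' : s * s + t * t <= 3 * d * (3 * d)) by nra.
    split; [|split].
    + nra.
    + apply Rnot_lt_le. intros F. nra.
    + apply Rnot_lt_le. intros F. nra.
Qed.

(** Each step moves both components by at most [3 d], hence by [6 d] in the sum norm, and [d] is
    halved each time; the total is [12 d]. *)
Theorem bronsted_rockafellar x0 (f0 : dual X) a0 d : 0 < d -> E x0 f0 a0 -> a0 - f0 x0 <= d² ->
  exists x (f : dual X), E x f (f x) /\ bnorm (x [-] x0) <= 12 * d /\ bnorm (f [-] f0) <= 12 * d.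
Proof.
  intros Hd E0 H0.
  set (good := fun q : X * dual X * R * R => let '(x, f, a, d) := q in
    E x f a /\ 0 < d /\ a - f x <= d²).
  set (St := { q | good q }).
  set (px := fun s : St => fst (fst (fst (proj1_sig s)))).
  set (pf := fun s : St => snd (fst (fst (proj1_sig s)))).
  set (pa := fun s : St => snd (fst (proj1_sig s))).
  set (pd := fun s : St => snd (proj1_sig s)).
  assert (Sgood : forall s, E (px s) (pf s) (pa s) /\ 0 < pd s /\ pa s - pf s (px s) <= (pd s)²).
  { intros [[[[x f] a] e] H]. exact H. }
  assert (Hnext : forall s : St, exists s' : St, pd s' = pd s / 2 /\
    bnorm (px s' [-] px s) <= 3 * pd s /\ bnorm (pf s' [-] pf s) <= 3 * pd s).
  { intros [[[[x f] a] e] [H1 [H2 H3]]].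
    destruct (bronsted_rockafellar_step H2 H1 H3) as [x1 [f1 [a1 [G1 [G2 [G3 G4]]]]]].
    assert (G : good (x1, f1, a1, e / 2)) by (split; [exact G1|]; split; [lra|exact G2]).
    exists (exist _ _ G). unfold px, pf, pd. simpl. auto. }
  destruct (choice_fun _ Hnext) as [nx Hnx].
  assert (G0 : good (x0, f0, a0, d)) by (split; [exact E0|]; split; [exact Hd|exact H0]).
  set (s := fix s n := match n with O => exist good _ G0 : St | S n => nx (s n) end).
  assert (s0 : px (s O) = x0 /\ pf (s O) = f0 /\ pd (s O) = d) by (repeat split; reflexivity).
  assert (sS : forall n, s (S n) = nx (s n)) by reflexivity. clearbody s.
  clearbody px pf pa pd.
  destruct (@halving_limit (prodB X (dualB X)) (fun n => 12 * pd (s n))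
              (fun n => (px (s n), pf (s n)))) as [[x f] Hl].
  - intros k. destruct (Sgood (s k)) as [_ [H _]]. lra.
  - intros k. change (bnorm (px (s (S k)) [-] px (s k)) + bnorm (pf (s (S k)) [-] pf (s k)) <=
      12 * pd (s k) / 2). rewrite sS. destruct (Hnx (s k)) as [_ [H1 H2]]. lra.
  - intros k. rewrite sS. destruct (Hnx (s k)) as [H _]. lra.
  - assert (Hl' : forall k, bnorm (px (s k) [-] x) <= 12 * pd (s k) /\
                            bnorm (pf (s k) [-] f) <= 12 * pd (s k)).
    { intros k. specialize (Hl k).
      change (bnorm (px (s k) [-] x) + bnorm (pf (s k) [-] f) <= 12 * pd (s k)) in Hl.
      assert (P1 := b_norm_ge0 _ (px (s k) [-] x)). assert (P2 := b_norm_ge0 _ (pf (s k) [-] f)). lra. }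
    destruct s0 as [Hx0 [Hf0 Hd0]].
    exists x, f. split; [|rewrite (bnorm_sub_sym x), (bnorm_sub_sym f), <- Hx0, <- Hf0, <- Hd0; apply Hl'].
    apply represented_closed. intros r Hr.
    assert (Hpow : forall k, pd (s k) = d * (/ 2) ^ k).
    { induction k as [|k IH]; simpl; [lra|]. rewrite sS, (proj1 (Hnx (s k))), IH. field. }
    destruct (@pow_half_small d (Rmin 1 (r / 12))) as [N HN]; [apply Rmin_pos; lra|].
    rewrite <- Hpow in HN.
    assert (M1 := Rmin_l 1 (r / 12)). assert (M2 := Rmin_r 1 (r / 12)).
    destruct (Sgood (s N)) as [G1 [G2 G3]]. destruct (Hl' N) as [L1 L2].
    exists (px (s N)), (pf (s N)), (pa (s N)). split; [exact G1|].
    unfold Rsqr in G3. repeat split; nra.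
Qed.

Lemma is_dual_bound (p : dual X -> R) : is_dual p ->
  exists K, 0 <= K /\ forall f, Rabs (p f) <= K * bnorm f.
Proof.
  intros [_ [M HM]]. exists (Rabs M). split; [apply Rabs_pos|]. intros f.
  eapply Rle_trans; [apply HM|]. apply Rmult_le_compat_r; [apply b_norm_ge0|apply Rle_abs].
Qed.

(* The operator is of type (NI). Anchoring [strong_approx_min] at the origin of [X] with a small
   weight [mu] on the [X]-component makes the error term [mu * |p|^2 / 2] negligible. *)
Lemma represented_NI (p : dual X -> R) (f0 : dual X) eps : is_dual p -> 0 < eps ->
  exists y g, E y g (g y) /\ g y - f0 y - p g + p f0 < eps.
Proof.
  intros Dp He. assert (Lp := proj1 Dp). destruct (is_dual_bound Dp) as [K [HK Hp]].
  (* Chosen so that [mu / 2 * (K + 1)²] equals [eps / 4]. *)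
  set (mu := eps / (2 * (K + 1)²)).
  assert (HK1 : 0 < (K + 1)²) by (apply Rsqr_pos_lt; lra).
  assert (Hmu : 0 < mu) by (unfold mu; apply Rdiv_lt_0_compat; lra).
  set (im := / (2 * mu)).
  assert (Him : 0 < im) by (unfold im; apply Rinv_0_lt_compat; lra).
  set (B := im + 1 + K).
  (* [d] is the displacement granted to [bronsted_rockafellar]; [d * B] collects all its effects
     except those that the quadratic terms absorb. *)
  set (d := Rmin 1 (eps / 4 / B)).
  assert (HB : 1 <= B) by (unfold B; lra).
  assert (Hd : 0 < d) by (apply Rmin_pos; [lra|apply Rdiv_lt_0_compat; lra]).
  assert (M1 := Rmin_l 1 (eps / 4 / B)). assert (M2 := Rmin_r 1 (eps / 4 / B)). fold d in M1, M2.
  assert (M3 : d * B <= eps / 4).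
  { apply Rmult_le_compat_r with (r := B) in M2; [|lra].
    unfold Rdiv in M2. rewrite (Rmult_assoc _ (/ B)), Rinv_l in M2 by lra. lra. }
  set (t := d / 12). assert (Ht : 0 < t) by (unfold t; lra).
  assert (Ht2 : t² <= eps / 4) by (unfold Rsqr, t; nra).
  destruct (@strong_approx_min X E (fun _ => 0) f0 (eq bzero) mu (t²) Ecvx Estrong)
    as [y [g [a [c [Ea [<- H]]]]]].
  - apply (@is_dual_zero (dualB X)).
  - intros u v l Hl <- <-. vlin.
  - intros f eta Heta. exists bzero. split; [reflexivity|]. rewrite (lin_zero (dual_lin f)). lra.
  - exact Hmu.
  - apply Rsqr_pos_lt. lra.
  - replace (y [-] bzero) with y in H by vlin. fold im in H.
    assert (HY := b_norm_ge0 _ y). assert (HN := b_norm_ge0 _ (g [-] f0)).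
    (* This splits every product involving [bnorm y] or [bnorm (g [-] f0)], neither of which is
       bounded in advance, into quadratic terms available in [H] and small constants. *)
    assert (Young : forall u v, u * v <= mu / 2 * u² + im * v²).
    { intros u v.
      assert (Q : 0 <= mu / 2 * (u - v / mu)²).
      { apply Rmult_le_pos; [lra|apply Rle_0_sqr]. }
      replace (mu / 2 * (u - v / mu)²) with (mu / 2 * u² + im * v² - u * v) in Q
        by (unfold Rsqr, im; field; lra). lra. }
    assert (HP := dual_bound_ge (g [-] f0) y). rewrite deval_sub in HP.
    assert (HA := Eabove Ea).
    assert (Y1 := Young (bnorm y) (bnorm (g [-] f0))).
    destruct (@bronsted_rockafellar y g a t Ht Ea) as [y' [g' [E' [D1 D2]]]]; [lra|].
    replace (12 * t) with d in D1, D2 by (unfold t; field).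
    exists y', g'. split; [exact E'|].
    assert (Eq : g' y' - f0 y' - p g' + p f0 =
      (g y - f0 y) + dapp (g' [-] g) y + dapp (g [-] f0) (y' [-] y) + dapp (g' [-] g) (y' [-] y)
      - p (g [-] f0) - p (g' [-] g)).
    { rewrite !deval_sub, !(lin_sub (dual_lin _)), !(lin_sub Lp). ring. }
    rewrite Eq. clear Eq.
    assert (C1 := dual_bound_le (g' [-] g) y). assert (C2 := dual_bound_le (g [-] f0) (y' [-] y)).
    assert (C3 := dual_bound_le (g' [-] g) (y' [-] y)).
    assert (C4 := Hp (g [-] f0)). assert (C5 := Hp (g' [-] g)).
    assert (C4' := neg_abs_le (p (g [-] f0))). assert (C5' := neg_abs_le (p (g' [-] g))).
    assert (P1 := b_norm_ge0 _ (y' [-] y)). assert (P2 := b_norm_ge0 _ (g' [-] g)).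
    assert (Y2 := Young (bnorm y) d). assert (Y3 := Young (K + d) (bnorm (g [-] f0))).
    assert (F1 : bnorm (g' [-] g) * bnorm y <= d * bnorm y) by (apply Rmult_le_compat_r; lra).
    assert (F2 : bnorm (g [-] f0) * bnorm (y' [-] y) <= bnorm (g [-] f0) * d)
      by (apply Rmult_le_compat_l; lra).
    assert (F3 : bnorm (g' [-] g) * bnorm (y' [-] y) <= d * d) by (apply Rmult_le_compat; lra).
    assert (F4 : K * bnorm (g' [-] g) <= K * d) by (apply Rmult_le_compat_l; lra).
    assert (F5 : mu / 2 * (K + d)² <= eps / 4).
    { assert ((K + d)² <= (K + 1)²) by (apply Rsqr_incr_1; lra).
      apply Rle_trans with (mu / 2 * (K + 1)²); [apply Rmult_le_compat_l; lra|].
      unfold mu. right. field. lra. }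
    assert (F6 : im * d² + d * d + K * d <= d * B).
    { assert (Hdd : d² <= d) by (unfold Rsqr; nra).
      assert (im * d² <= im * d) by (apply Rmult_le_compat_l; lra).
      unfold B. unfold Rsqr in *. lra. }
    lra.
Qed.

(** The convex hull of the points [(x, f, f x)] with [(x, f)] in the contact set, as an
    intersection; affine inequalities on the contact set extend to it at once. *)
Definition graph_hull (y : X) (g : dual X) (a : R) :=
  forall D, ecvx D -> (forall x f, E x f (f x) -> D x f (f x)) -> D y g a.

Lemma graph_hull_cvx : ecvx graph_hull.
Proof. intros x f a y g b l Hl H1 H2 D HD HM. apply HD; [exact Hl|now apply H1|now apply H2]. Qed.

(** Type (NI) says precisely that the graph points alone already realize [h^* >= c]. *)
Lemma graph_hull_strong : estrong graph_hull.
Proof.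
  intros f p eps Dp He. destruct (represented_NI f Dp He) as [y [g [H1 H2]]].
  exists y, g, (g y). split; [|lra]. intros D _ HM. now apply HM.
Qed.

(* Running [strong_approx_min] on the hull of the graph instead of on [E] makes
   [a - f0 y - p g + p f0] nonnegative, so that the quadratic terms must be small. *)
Lemma represented_approx (p : dual X -> R) (f0 : dual X) (C : X -> Prop) K e :
  is_dual p -> cvx_set C -> pdense p C -> (forall c, C c -> bnorm c <= K) -> 0 < e ->
  (forall y g, E y g (g y) -> 0 <= g y - f0 y - p g + p f0) ->
  exists x (f : dual X) c, E x f (f x) /\ C c /\ bnorm (x [-] c) <= e /\ bnorm (f [-] f0) <= e.
Proof.
  intros Dp CC pC HCK He Hrel. assert (Lp := proj1 Dp). destruct (is_dual_bound Dp) as [Kp [HKp Hp]].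
  assert (HK : 0 <= K).
  { destruct (pC f0 1 Rlt_0_1) as [c [Hc _]]. specialize (HCK c Hc).
    assert (A := b_norm_ge0 _ c). lra. }
  (* [12 * d] is [e / 2]; the other half of [e] is left for [s], which bounds both quadratic
     displacements. [s * B] bounds the gap [a - g y]. *)
  set (d := e / 24). assert (Hd : 0 < d) by (unfold d; lra).
  set (B := K + Kp + 2). assert (HB : 2 <= B) by (unfold B; lra).
  set (s := Rmin (Rmin 1 (e / 2)) (d² / B)).
  assert (Hd2 : 0 < d²) by (apply Rsqr_pos_lt; lra).
  assert (Hs : 0 < s) by (repeat apply Rmin_pos; try lra; apply Rdiv_lt_0_compat; lra).
  assert (M1 : s <= Rmin 1 (e / 2)) by apply Rmin_l.
  assert (M2 := Rmin_l 1 (e / 2)). assert (M3 := Rmin_r 1 (e / 2)).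
  assert (M4 : s <= d² / B) by apply Rmin_r.
  assert (M5 : s * B <= d²).
  { apply Rmult_le_compat_r with (r := B) in M4; [|lra].
    unfold Rdiv in M4. rewrite Rmult_assoc, Rinv_l in M4 by lra. lra. }
  destruct (@strong_approx_min X graph_hull p f0 C 1 (s² / 2) graph_hull_cvx graph_hull_strong Dp CC pC)
    as [y [g [a [c [Ea [Hc H]]]]]]; [lra| |].
  { assert (0 < s²) by (apply Rsqr_pos_lt; lra). lra. }
  (* The expression is affine in [(y, g, a)] and nonnegative on the graph by [Hrel], hence on the
     hull. *)
  assert (Hpsi : 0 <= a - f0 y - p g + p f0).
  { apply (Ea (fun y g a => 0 <= a - f0 y - p g + p f0)); [|exact Hrel].
    intros x f b x' f' b' l Hl H1 H2.
    rewrite (lin_add (dual_lin f0)), !(lin_scal (dual_lin f0)), (lin_add Lp), !(lin_scal Lp). nra. }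
  assert (Ey : E y g a) by (apply (Ea E Ecvx); auto).
  assert (P1 := b_norm_ge0 _ (y [-] c)). assert (P2 := b_norm_ge0 _ (g [-] f0)).
  assert (S1 : bnorm (y [-] c) <= s).
  { apply Rnot_lt_le. intros F. unfold Rsqr in H. nra. }
  assert (S2 : bnorm (g [-] f0) <= s).
  { apply Rnot_lt_le. intros F. unfold Rsqr in H. nra. }
  assert (Yb : bnorm y <= s + K).
  { assert (A := bnorm_le_sub y c). specialize (HCK c Hc). lra. }
  assert (A1 := dual_bound_ge (g [-] f0) y). rewrite deval_sub in A1.
  assert (A2 := Hp (g [-] f0)). assert (A3 := Rle_abs (p (g [-] f0))).
  rewrite (lin_sub Lp) in A3 at 1.
  assert (A4 : bnorm (g [-] f0) * bnorm y <= s * (s + K)).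
  { apply Rmult_le_compat; try lra. apply b_norm_ge0. }
  assert (A5 : Kp * bnorm (g [-] f0) <= Kp * s) by (apply Rmult_le_compat_l; lra).
  assert (A6 : a - g y <= d²).
  { assert (0 <= 1 / 2 * (bnorm (y [-] c))²) by (apply Rmult_le_pos; [lra|apply Rle_0_sqr]).
    assert (0 <= / (2 * 1) * (bnorm (g [-] f0))²) by (apply Rmult_le_pos; [lra|apply Rle_0_sqr]).
    unfold B in M5. unfold Rsqr at 1 in H. unfold Rsqr in *. nra. }
  destruct (bronsted_rockafellar Hd Ey A6) as [x [f [Exf [B1 B2]]]].
  replace (12 * d) with (e / 2) in B1, B2 by (unfold d; field).
  exists x, f, c. split; [exact Exf|]. split; [exact Hc|].
  assert (T1 := bnorm_sub_tri x y c). assert (T2 := bnorm_sub_tri f g f0). split; lra.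
Qed.
End RepresentedOperator.

(** * Translation between [bidual] and continuous functionals on [dualB X] *)

Section BidualBridge.
Context {X : Banach}.

Lemma bidual_is_dual (p : bidual X) : is_dual (fun f : dual X => p f).
Proof.
  destruct p as [p [Hp [M HM]]]. simpl. split.
  - intros a f g. replace (a [*] f [+] g) with (dcomb a f 1 g); [rewrite Hp; ring|].
    dual_ring.
  - exists M. intros f. apply HM. apply dnorm_bound.
Qed.

Lemma bnorm_dnorm_le (f : dual X) r : bnorm f <= r -> dnorm_le f r.
Proof. intros H. apply dnorm_le_mono with (bnorm f); [exact H|apply dnorm_bound]. Qed.

Lemma dnorm_le_bnorm (f : dual X) r : 0 <= r -> dnorm_le f r -> bnorm f <= r.
Proof. intros Hr H. now apply dnorm_least. Qed.

(** A nonzero vector forces [0 <= r] whenever [dnorm_le f r] holds, and then [bnorm f <= r]. *)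
Lemma mk_bidual (q : dual X -> R) : (exists x : X, x <> bzero) -> is_dual q ->
  exists p : bidual X, forall f, p f = q f.
Proof.
  intros [x0 Hx0] [Lq [M HM]].
  assert (Hq : is_bidual q).
  { split.
    - intros a f b g. rewrite dcombE, (lin_add Lq), !(lin_scal Lq). reflexivity.
    - exists (Rabs M). intros f r Hr.
      assert (Hr0 : 0 <= r).
      { specialize (Hr x0). assert (A := Rabs_pos (f x0)). assert (B := b_norm_ge0 _ x0).
        assert (bnorm x0 <> 0) by (intros H; now apply b_norm_eq0 in H). nra. }
      eapply Rle_trans; [apply HM|]. assert (A := dnorm_le_bnorm _ Hr0 Hr).
      assert (B := Rle_abs M). assert (C := Rabs_pos M). assert (D := b_norm_ge0 _ f). nra. }
  now exists (exist _ q Hq).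
Qed.

Lemma gossez_pairing (S : op X) (p : bidual X) f : gossez S p f <->
  forall y g, S y g -> 0 <= g y - f y - p g + p f.
Proof.
  assert (Lp := proj1 (bidual_is_dual p)).
  split; intros H y g Hyg; specialize (H y g Hyg);
    rewrite dsubE, (lin_sub Lp), deval_sub in *; lra.
Qed.

Lemma monotone_pairing (f g : dual X) (x y : X) :
  dsub f g (bsub x y) = f x - g x - f y + g y.
Proof. rewrite dsubE, deval_sub, !(lin_sub (dual_lin _)). ring. Qed.
End BidualBridge.

(** Both claims are [represented_approx]: a point of a monotone extension is approached with [C] a
    singleton and then belongs to the closed contact set, a point of Gossez's closure with [C] a
    bounded weak-star neighbourhood. *)
Theorem represented_typeD (X : Banach) (E : X -> dual X -> R -> Prop) :
  ecvx E -> eclosed E -> eabove E -> estrong E -> gossez_typeD (fun x f => E x f (f x)).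
Proof.
  intros Ecvx Ecl Eab Est. split; [split|].
  - intros x f y g H1 H2. rewrite monotone_pairing. now apply (represented_monotone Ecvx Eab).
  - intros T HT Hsub x f HTx.
    apply (represented_closed Ecl Eab). intros r Hr.
    destruct (@represented_approx X E Ecvx Ecl Eab Est (fun g => g x) f (eq x) (bnorm x) r)
      as [y [g [c [Ey [<- [H1 H2]]]]]].
    + apply eval_is_dual.
    + intros u v l Hl <- <-. vlin.
    + intros g eta He. exists x. split; [reflexivity|lra].
    + intros c <-. lra.
    + exact Hr.
    + intros y g Hyg. specialize (HT x f y g HTx (Hsub _ _ Hyg)).
      rewrite monotone_pairing in HT. lra.
    + exists y, g, (g y). repeat split; auto. lra.
  - intros p f Hpf. rewrite gossez_pairing in Hpf.
    assert (Dp := bidual_is_dual p). destruct (is_dual_bound Dp) as [K [HK Hp]].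
    assert (Hn : forall n, 0 < / (INR n + 1)).
    { intros n. apply Rinv_0_lt_compat. assert (A := pos_INR n). lra. }
    (* The net is indexed by finite lists of functionals and precisions. The factor [1 + bnorm g]
       adds the width of the slab to the effect of the distance between [x] and [c]. *)
    assert (Hap : forall i : list (dual X) * nat, exists q : X * dual X,
      E (fst q) (snd q) (snd q (fst q)) /\ bnorm (fst q) <= K + 1 /\
      bnorm (snd q [-] f) <= / (INR (snd i) + 1) /\
      forall g, In g (fst i) -> Rabs (g (fst q) - p g) <= (1 + bnorm g) * / (INR (snd i) + 1)).
    { intros [F n]. cbn [fst snd]. set (e := / (INR n + 1)). assert (He : 0 < e) by apply Hn.
      assert (He1 : e <= 1).
      { unfold e. rewrite <- Rinv_1. apply Rinv_le_contravar; [lra|]. assert (A := pos_INR n). lra. }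
      destruct (weak_nbhd_pdense F Dp HK He Hp) as [C1 C2].
      destruct (@represented_approx X E Ecvx Ecl Eab Est _ f _ K e Dp C1 C2)
        as [x [h [c [Ex [[Hc1 Hc2] [H1 H2]]]]]].
      - intros c [Hc _]. exact Hc.
      - exact He.
      - exact Hpf.
      - exists (x, h). cbn [fst snd]. split; [exact Ex|]. split; [|split; [exact H2|]].
        + assert (A := bnorm_le_sub x c). lra.
        + intros g Hg. specialize (Hc2 g Hg).
          assert (A := dual_bound g (x [-] c)). rewrite (lin_sub (dual_lin g)) in A.
          assert (T := Rabs_triang (g x - g c) (g c - p g)).
          replace (g x - g c + (g c - p g)) with (g x - p g) in T by ring.
          assert (B := b_norm_ge0 _ g).
          assert (bnorm g * bnorm (x [-] c) <= bnorm g * e) by (apply Rmult_le_compat_l; lra).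
          lra. }
    destruct (choice_fun _ Hap) as [u Hu].
    assert (Hsmall : forall eps, 0 < eps -> exists n0, forall n, (n0 <= n)%nat -> / (INR n + 1) < eps).
    { intros eps He. destruct (INR_unbounded (/ eps)) as [n0 Hn0]. exists n0. intros n Hle.
      apply le_INR in Hle. rewrite <- (Rinv_inv eps).
      assert (0 < / eps) by now apply Rinv_0_lt_compat.
      apply Rinv_lt_contravar; [apply Rmult_lt_0_compat; lra|lra]. }
    exists (list (dual X) * nat)%type,
      (fun i j => incl (fst i) (fst j) /\ (snd i <= snd j)%nat),
      (fun i => fst (u i)), (fun i => snd (u i)).
    split; [|split; [|split; [|split]]].
    + split; [exact (inhabits (nil, O))|]. split; [|split].
      * intros i. split; [apply incl_refl|lia].
      * intros i j k [A1 A2] [B1 B2]. split; [now apply incl_tran with (fst j)|lia].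
      * intros i j. exists (fst i ++ fst j, max (snd i) (snd j)). simpl.
        repeat split; try lia; [now apply incl_appl, incl_refl|now apply incl_appr, incl_refl].
    + intros i. apply Hu.
    + exists (Rmax (K + 1) (bnorm f + 1)). intros i.
      assert (M1 := Rmax_l (K + 1) (bnorm f + 1)). assert (M2 := Rmax_r (K + 1) (bnorm f + 1)).
      destruct (Hu i) as [_ [H1 [H2 _]]]. split; [lra|].
      apply bnorm_dnorm_le. assert (A := bnorm_le_sub (snd (u i)) f).
      assert (/ (INR (snd i) + 1) <= 1).
      { rewrite <- Rinv_1. apply Rinv_le_contravar; [lra|]. assert (B := pos_INR (snd i)). lra. }
      lra.
    + intros g eps He. assert (B := b_norm_ge0 _ g).
      destruct (Hsmall (eps / (1 + bnorm g))) as [n0 Hn0]; [apply Rdiv_lt_0_compat; lra|].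
      exists (g :: nil, n0). intros i [H1 H2]. destruct (Hu i) as [_ [_ [_ H3]]].
      eapply Rle_lt_trans; [apply H3; apply H1; now left|].
      specialize (Hn0 _ H2). apply Rmult_lt_compat_l with (r := 1 + bnorm g) in Hn0; [|lra].
      replace ((1 + bnorm g) * (eps / (1 + bnorm g))) with eps in Hn0 by (field; lra). exact Hn0.
    + intros eps He. destruct (Hsmall eps He) as [n0 Hn0]. exists (nil, n0).
      intros i [_ H2]. destruct (Hu i) as [_ [_ [H3 _]]]. rewrite dsubE.
      apply bnorm_dnorm_le. specialize (Hn0 _ H2). lra.
Qed.

(** * Closures of representing sets *)

Section Closure.
Context {X : Banach}.

Definition eclosure (E : X -> dual X -> R -> Prop) : X -> dual X -> R -> Prop :=
  fun x f a => forall eps, 0 < eps -> exists y g b, E y g b /\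
    bnorm (x [-] y) <= eps /\ bnorm (f [-] g) <= eps /\ Rabs (a - b) <= eps.

Variable E : X -> dual X -> R -> Prop.

Lemma eclosure_sub x f a : E x f a -> eclosure E x f a.
Proof.
  intros H eps He. exists x, f, a. split; [exact H|].
  rewrite !bsub_self, !bnorm0, Rminus_diag, Rabs_R0. lra.
Qed.

Lemma comb_dist (V : Banach) (x y x' y' : V) l e : 0 <= l <= 1 ->
  bnorm (x [-] x') <= e -> bnorm (y [-] y') <= e ->
  bnorm ((l [*] x [+] (1 - l) [*] y) [-] (l [*] x' [+] (1 - l) [*] y')) <= e.
Proof.
  intros Hl H1 H2.
  replace ((l [*] x [+] (1 - l) [*] y) [-] (l [*] x' [+] (1 - l) [*] y'))
    with (l [*] (x [-] x') [+] (1 - l) [*] (y [-] y')) by vlin.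
  eapply Rle_trans; [now apply bnorm_comb|]. nra.
Qed.

Lemma eclosure_cvx : ecvx E -> ecvx (eclosure E).
Proof.
  intros CE x f a y g b l Hl H1 H2 eps He.
  destruct (H1 eps He) as [x' [f' [a' [E1 [A1 [B1 C1]]]]]].
  destruct (H2 eps He) as [y' [g' [b' [E2 [A2 [B2 C2]]]]]].
  exists (l [*] x' [+] (1 - l) [*] y'), (l [*] f' [+] (1 - l) [*] g'), (l * a' + (1 - l) * b').
  split; [now apply CE|]. split; [now apply comb_dist|]. split; [now apply comb_dist|].
  replace (l * a + (1 - l) * b - (l * a' + (1 - l) * b')) with (l * (a - a') + (1 - l) * (b - b')) by ring.
  eapply Rle_trans; [apply Rabs_triang|]. rewrite !Rabs_mult, (Rabs_right l), (Rabs_right (1 - l)) by lra.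
  nra.
Qed.

Lemma eclosure_closed : eclosed (eclosure E).
Proof.
  intros x f a H eps He. destruct (H (eps / 2)) as [y [g [b [H1 [A1 [B1 C1]]]]]]; [lra|].
  destruct (H1 (eps / 2)) as [y' [g' [b' [E' [A2 [B2 C2]]]]]]; [lra|].
  exists y', g', b'. split; [exact E'|].
  assert (T1 := bnorm_sub_tri x y y'). assert (T2 := bnorm_sub_tri f g g').
  assert (T3 := Rabs_triang (a - b) (b - b')). replace (a - b + (b - b')) with (a - b') in T3 by ring.
  repeat split; lra.
Qed.

Lemma eclosure_above : eabove E -> eabove (eclosure E).
Proof.
  intros AE x f a H. apply Rnot_lt_le. intros C.
  assert (Px := b_norm_ge0 _ x). assert (Pf := b_norm_ge0 _ f).
  set (K := bnorm x + bnorm f + 3). set (d := f x - a).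
  set (e := Rmin 1 (d / 2 / K)).
  assert (He : 0 < e) by (apply Rmin_pos; [lra|repeat apply Rdiv_lt_0_compat; unfold d, K; lra]).
  assert (M1 := Rmin_l 1 (d / 2 / K)). assert (M2 := Rmin_r 1 (d / 2 / K)). fold e in M1, M2.
  assert (M3 : e * K <= d / 2).
  { apply Rmult_le_compat_r with (r := K) in M2; [|unfold K; lra].
    unfold Rdiv in M2. rewrite (Rmult_assoc _ (/ K)), Rinv_l in M2 by (unfold K; lra). lra. }
  destruct (H e He) as [y [g [b [Eb [H1 [H2 H3]]]]]].
  rewrite bnorm_sub_sym in H1. rewrite bnorm_sub_sym in H2.
  assert (A := pairing_close x y f g (Rlt_le _ _ He) H1 H2). assert (B := AE _ _ _ Eb).
  assert (A' := neg_abs_le (g y - f x)). assert (H3' := neg_abs_le (a - b)).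
  assert (e * (bnorm x + bnorm f + e) <= e * (bnorm x + bnorm f + 1)) by (apply Rmult_le_compat_l; lra).
  unfold K in M3. unfold d in *. lra.
Qed.

Lemma eclosure_strong : estrong E -> estrong (eclosure E).
Proof.
  intros SE f p eps Dp He. destruct (SE f p eps Dp He) as [x [g [a [Ea H]]]].
  exists x, g, a. split; [now apply eclosure_sub|exact H].
Qed.

(* The Fitzpatrick inequality, obtained by differentiating [a - f x >= 0] along the segment from
   [(x, f, f x)] to [(y, g, a)]. *)
Lemma represented_fitzpatrick x (f : dual X) y g a :
  ecvx E -> eabove E -> E x f (f x) -> E y g a -> f y + g x - a <= f x.
Proof.
  intros CE AE E1 E2. apply Rnot_lt_le. intros C.
  set (D := f y + g x - a - f x). set (Q := f y + g x - f x - g y).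
  assert (HD : 0 < D) by (unfold D; lra). assert (HQ := Rabs_pos Q). assert (HQ' := Rle_abs Q).
  set (l := Rmin 1 (D / 2 / (Rabs Q + 1))).
  assert (Hl : 0 < l) by (apply Rmin_pos; [lra|repeat apply Rdiv_lt_0_compat; lra]).
  assert (M1 := Rmin_l 1 (D / 2 / (Rabs Q + 1))).
  assert (M2 := Rmin_r 1 (D / 2 / (Rabs Q + 1))). fold l in M1, M2.
  apply Rmult_le_compat_r with (r := Rabs Q + 1) in M2; [|lra].
  unfold Rdiv in M2. rewrite (Rmult_assoc _ (/ (Rabs Q + 1))), Rinv_l in M2 by lra.
  assert (A := AE _ _ _ (@CE y g a x f (f x) l ltac:(lra) E2 E1)).
  rewrite deval_add, !deval_scal, !(lin_add (dual_lin _)), !(lin_scal (dual_lin _)) in A.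
  assert (B : l * D <= l * (l * Q)) by (unfold D, Q; nra).
  assert (B' : D <= l * Q) by nra.
  assert (l * Q <= l * Rabs Q) by (apply Rmult_le_compat_l; lra). lra.
Qed.
End Closure.

(** * The parallel sum *)

Section Parallel.
Context {X : Banach}.

(** What the duality argument uses of an operator and its strong representative function, in a form
    that is stable under translation. *)
Record represents (S : op X) (F : X -> dual X -> R -> Prop) : Prop := {
  rp_cvx : ecvx F;
  rp_closed : eclosed F;
  rp_above : eabove F;
  rp_strong : estrong F;
  rp_graph : forall x f, S x f -> F x f (f x);
  rp_max : forall x (f : dual X), (forall y g, S y g -> 0 <= f x - g x - f y + g y) -> S x f
}.

(** The condition [0] in [ic] of the difference of the projections, with the closed linear space [W]
    in place of the affine hull. *)
Record qualified (F G : X -> dual X -> R -> Prop) (W : dual X -> Prop) : Prop := {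
  ql_lin : forall a v w, W v -> W w -> W (a [*] v [+] w);
  ql_closed : forall w, nclosure W w -> W w;
  ql_range : forall u g b v g' c, F u g b -> G v g' c -> W (g [-] g');
  ql_zero : exists u g b v c, F u g b /\ G v g c;
  ql_absorb : forall w, W w -> exists delta, 0 < delta /\ forall l, 0 <= l <= delta ->
     exists u g b v g' c, F u g b /\ G v g' c /\ l [*] w = g [-] g'
}.

(** Robinson-Ursescu for the relation sending [(u, g, v, g', b, c)] to [g [-] g']. Carrying [b] and
    [c] as coordinates makes the relation closed and bounds the function values too. *)
Lemma qualified_ball F G W : ecvx F -> eclosed F -> ecvx G -> eclosed G -> qualified F G W ->
  exists r K, 0 < r /\ forall w, W w -> bnorm w <= r ->
    exists u g b v g' c, F u g b /\ G v g' c /\ w = g [-] g' /\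
      bnorm u <= K /\ bnorm g <= K /\ b <= K /\ bnorm v <= K /\ c <= K.
Proof.
  intros CF ClF CG ClG Q.
  set (Y := prodB (prodB (prodB X (dualB X)) (prodB X (dualB X))) (prodB RB RB)).
  set (H := fun (y : Y) (w : dualB X) =>
    let '(((u, g), (v, g')), (b, c)) := (y : (X * dual X * (X * dual X) * (R * R))%type) in
    F u g b /\ G v g' c /\ w = g [-] g').
  destruct (@robinson_ursescu Y (dualB X) H) with (W := W) as [r [K [Hr HK]]].
  - intros [[[u g] [v g']] [b c]] w [[[u1 g1] [v1 g1']] [b1 c1]] w1 l Hl [A1 [A2 ->]] [B1 [B2 ->]].
    split; [now apply CF|]. split; [now apply CG|]. dual_ring.
  - intros [[[u g] [v g']] [b c]] w Hap.
    assert (Hap' : forall eps, 0 < eps -> exists u1 g1 b1 v1 g1' c1, F u1 g1 b1 /\ G v1 g1' c1 /\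
      bnorm (u [-] u1) <= eps /\ bnorm (g [-] g1) <= eps /\ Rabs (b - b1) <= eps /\
      bnorm (v [-] v1) <= eps /\ bnorm (g' [-] g1') <= eps /\ Rabs (c - c1) <= eps /\
      bnorm (w [-] (g1 [-] g1')) <= eps).
    { intros eps He. destruct (Hap eps He) as [[[[u1 g1] [v1 g1']] [b1 c1]] [w1 [[A1 [A2 ->]] [N1 N2]]]].
      exists u1, g1, b1, v1, g1', c1.
      change (bnorm (u [-] u1) + bnorm (g [-] g1) + (bnorm (v [-] v1) + bnorm (g' [-] g1')) +
              (Rabs (b - b1) + Rabs (c - c1)) <= eps) in N1.
      assert (P1 := b_norm_ge0 _ (u [-] u1)). assert (P2 := b_norm_ge0 _ (g [-] g1)).
      assert (P3 := b_norm_ge0 _ (v [-] v1)). assert (P4 := b_norm_ge0 _ (g' [-] g1')).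
      assert (P5 := Rabs_pos (b - b1)). assert (P6 := Rabs_pos (c - c1)).
      repeat split; try assumption; lra. }
    split; [|split].
    + apply ClF. intros eps He. destruct (Hap' eps He) as [u1 [g1 [b1 [v1 [g1' [c1 Hq]]]]]].
      exists u1, g1, b1. tauto.
    + apply ClG. intros eps He. destruct (Hap' eps He) as [u1 [g1 [b1 [v1 [g1' [c1 Hq]]]]]].
      exists v1, g1', c1. tauto.
    + apply bnorm_sub_eq0. intros eps He.
      destruct (Hap' (eps / 3)) as [u1 [g1 [b1 [v1 [g1' [c1 [_ [_ [_ [N1 [_ [_ [N2 [_ N3]]]]]]]]]]]]]]; [lra|].
      replace (w [-] (g [-] g')) with
        ((w [-] (g1 [-] g1')) [+] ((g' [-] g1') [-] (g [-] g1)))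
        by dual_ring.
      eapply Rle_trans; [apply b_norm_tri|].
      assert (T := bnorm_sub_le (g' [-] g1') (g [-] g1)). lra.
  - exact (ql_lin Q).
  - exact (ql_closed Q).
  - intros [[[u g] [v g']] [b c]] w [A1 [A2 ->]]. exact (ql_range Q _ _ _ _ _ _ A1 A2).
  - destruct (ql_zero Q) as [u [g [b [v [c [A1 A2]]]]]].
    exists (((u, g), (v, g)), (b, c)). split; [exact A1|]. split; [exact A2|].
    dual_ring.
  - intros w Hw. destruct (ql_absorb Q w Hw) as [d [Hd Hl]]. exists d. split; [exact Hd|].
    intros l Hl'. destruct (Hl l Hl') as [u [g [b [v [g' [c [A1 [A2 A3]]]]]]]].
    exists (((u, g), (v, g')), (b, c)). split; [exact A1|]. split; [exact A2|exact A3].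
  - exists r, K. split; [exact Hr|]. intros w Hw Hwr.
    destruct (HK w Hw Hwr) as [[[[u g] [v g']] [b c]] [N [A1 [A2 A3]]]].
    exists u, g, b, v, g', c.
    change (bnorm u + bnorm g + (bnorm v + bnorm g') + (Rabs b + Rabs c) <= K) in N.
    assert (P1 := b_norm_ge0 _ u). assert (P2 := b_norm_ge0 _ g).
    assert (P3 := b_norm_ge0 _ v). assert (P4 := b_norm_ge0 _ g').
    assert (P5 := Rabs_pos b). assert (P6 := Rabs_pos c).
    assert (P7 := Rle_abs b). assert (P8 := Rle_abs c).
    repeat split; try assumption; lra.
Qed.

(* Fenchel duality for the value function of the perturbed problem in which the two
   [X^*]-components are allowed to differ; [qualified_ball] bounds it near the origin. *)
Lemma qualified_dual F G W (f : dual X) (p : dual X -> R) m :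
  ecvx F -> eclosed F -> ecvx G -> eclosed G -> qualified F G W -> is_dual p ->
  (forall u v g b c, F u g b -> G v g c -> f u + f v + p g - b - c <= m) ->
  exists q, is_dual q /\ forall u g b v g' c, F u g b -> G v g' c ->
    f u + f v + p g - b - c - q (g [-] g') <= m.
Proof.
  intros CF ClF CG ClG Q Dp Hm. assert (Lp := proj1 Dp).
  destruct (qualified_ball CF ClF CG ClG Q) as [r [K [Hr HK]]].
  destruct (is_dual_bound Dp) as [Kp [HKp Hp]].
  assert (Pf := b_norm_ge0 _ f).
  set (K1 := 2 * K + 2 * (bnorm f * K) + Kp * K).
  assert (Hball : forall w, W w -> bnorm w <= r -> exists u g b v g' c, F u g b /\ G v g' c /\
    w = g [-] g' /\ b + c - f u - f v - p g <= K1).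
  { intros w Hw Hwr.
    destruct (HK w Hw Hwr) as [u [g [b [v [g' [c [A1 [A2 [A3 [N1 [N2 [N3 [N4 N5]]]]]]]]]]]]].
    exists u, g, b, v, g', c. repeat split; try assumption.
    assert (B1 := dual_bound_ge f u). assert (B2 := dual_bound_ge f v).
    assert (B3 := Hp g). assert (B4 := neg_abs_le (p g)).
    assert (bnorm f * bnorm u <= bnorm f * K) by (apply Rmult_le_compat_l; lra).
    assert (bnorm f * bnorm v <= bnorm f * K) by (apply Rmult_le_compat_l; lra).
    assert (Kp * bnorm g <= Kp * K) by (apply Rmult_le_compat_l; lra).
    unfold K1. lra. }
  assert (W0 : W bzero).
  { destruct (ql_zero Q) as [u [g [b [v [c [A1 A2]]]]]]. assert (A := ql_range Q _ _ _ _ _ _ A1 A2).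
    now rewrite bsub_self in A. }
  assert (HK1 : 0 <= K1 + m).
  { destruct (Hball bzero W0) as [u [g [b [v [g' [c [A1 [A2 [A3 A4]]]]]]]]]; [rewrite bnorm0; lra|].
    assert (g = g'); [|subst g'; specialize (Hm u v g b c A1 A2); lra].
    apply bnorm_sub_eq0. intros eps He. rewrite <- A3, bnorm0. lra. }
  (* The value function is at most [K1] on the ball of radius [r] and at least [- m] at the origin;
     by convexity it decreases from there with slope at most [N]. *)
  set (N := (K1 + m) / r).
  assert (HN : 0 <= N) by (unfold N; apply Rmult_le_pos; [exact HK1|left; now apply Rinv_0_lt_compat]).
  destruct (@fenchel_sandwich (dualB X)
    (fun w a => exists u g b v g' c, F u g b /\ G v g' c /\ w = g [-] g' /\
       a = b + c - f u - f v - p g) (fun w => N * bnorm w) (- m)) as [L [LL HL]].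
  - destruct (ql_zero Q) as [u [g [b [v [c [A1 A2]]]]]]. do 2 eexists. exists u, g, b, v, g, c. eauto.
  - intros w a w' a' l Hl [u [g [b [v [g' [c [A1 [A2 [-> ->]]]]]]]]]
      [u1 [g1 [b1 [v1 [g1' [c1 [B1 [B2 [-> ->]]]]]]]]].
    exists (l [*] u [+] (1 - l) [*] u1), (l [*] g [+] (1 - l) [*] g1), (l * b + (1 - l) * b1),
      (l [*] v [+] (1 - l) [*] v1), (l [*] g' [+] (1 - l) [*] g1'), (l * c + (1 - l) * c1).
    split; [now apply CF|]. split; [now apply CG|]. split.
    + dual_ring.
    + rewrite !(lin_add (dual_lin f)), !(lin_scal (dual_lin f)), (lin_add Lp), !(lin_scal Lp). ring.
  - now apply norm_cvx.
  - intros w a [u [g [b [v [g' [c [A1 [A2 [Ew ->]]]]]]]]].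
    assert (Ww : W w) by (rewrite Ew; exact (ql_range Q _ _ _ _ _ _ A1 A2)).
    destruct (Req_dec (bnorm w) 0) as [Z|Z].
    { rewrite Z. assert (g = g'); [|subst g'; specialize (Hm u v g b c A1 A2); lra].
      apply bnorm_sub_eq0. intros eps He. rewrite <- Ew, Z. lra. }
    assert (Pw : 0 < bnorm w) by (assert (A := b_norm_ge0 _ w); lra).
    set (n := bnorm w) in *.
    (* A point opposite to [w] on the sphere of radius [r]; the weight [s] below places the origin
       between the two, where the dual components agree and [Hm] applies. *)
    destruct (Hball ((- (r / n)) [*] w)) as [u1 [g1 [b1 [v1 [g1' [c1 [B1 [B2 [B3 B4]]]]]]]]].
    { rewrite <- (b_add0 _ (_ [*] w)). now apply (ql_lin Q). }
    { rewrite b_norm_scal, Rabs_Ropp, Rabs_right.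
      - fold n. right. field. lra.
      - apply Rle_ge. left. now apply Rdiv_lt_0_compat. }
    set (s := r / (r + n)).
    assert (Hs0 : 0 < s) by (unfold s; apply Rdiv_lt_0_compat; lra).
    assert (Hs1 : 1 - s = s * (n / r)) by (unfold s; field; lra).
    assert (Hnr : 0 < n / r) by now apply Rdiv_lt_0_compat.
    assert (Hs : 0 <= s <= 1) by nra.
    assert (Eg : s [*] g [+] (1 - s) [*] g1 = s [*] g' [+] (1 - s) [*] g1').
    { apply bnorm_sub_eq0. intros eps He.
      replace ((s [*] g [+] (1 - s) [*] g1) [-] (s [*] g' [+] (1 - s) [*] g1'))
        with (s [*] (g [-] g') [+] (1 - s) [*] (g1 [-] g1')) by vlin.
      rewrite <- B3, <- Ew.
      replace (s [*] w [+] (1 - s) [*] (- (r / n) [*] w)) with (@bzero (dualB X)).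
      - rewrite bnorm0. lra.
      - unfold s. vlin. }
    assert (H := CG _ _ _ _ _ _ s Hs A2 B2). rewrite <- Eg in H.
    specialize (Hm _ _ _ _ _ (CF _ _ _ _ _ _ s Hs A1 B1) H).
    rewrite !(lin_add (dual_lin f)), !(lin_scal (dual_lin f)), (lin_add Lp), !(lin_scal Lp) in Hm.
    assert (F1 : s * (b + c - f u - f v - p g) >= - m - (1 - s) * K1).
    { assert ((1 - s) * (b1 + c1 - f u1 - f v1 - p g1) <= (1 - s) * K1)
        by (apply Rmult_le_compat_l; lra). lra. }
    assert (F2 : s * (N * n) = (1 - s) * (K1 + m)) by (rewrite Hs1; unfold N; field; lra).
    apply Rmult_le_reg_l with s; [exact Hs0|]. nra.
  - exists L. split.
    + destruct (ql_zero Q) as [u [g [b [v [c [A1 A2]]]]]].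
      apply (lin_bounded_dual LL) with (L (g [-] g) + (b + c - f u - f v - p g) + N - - m).
      intros w Hw.
      assert (A : L w - L (g [-] g) <= (b + c - f u - f v - p g) + N * bnorm w - - m).
      { apply HL. exists u, g, b, v, g, c. auto. }
      nra.
    + intros u g b v g' c A1 A2.
      assert (A : L bzero - L (g [-] g') <= (b + c - f u - f v - p g) + N * bnorm (@bzero (dualB X)) - - m).
      { apply HL. exists u, g, b, v, g', c. auto. }
      rewrite (lin_zero LL), bnorm0 in A. lra.
Qed.

Definition epi_sum (F G : X -> dual X -> R -> Prop) : X -> dual X -> R -> Prop :=
  fun x f a => exists u v b c, F u f b /\ G v f c /\ x = u [+] v /\ a = b + c.

Lemma epi_sum_cvx F G : ecvx F -> ecvx G -> ecvx (epi_sum F G).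
Proof.
  intros CF CG x f a y g b l Hl [u [v [c [d [A1 [A2 [-> ->]]]]]]] [u' [v' [c' [d' [B1 [B2 [-> ->]]]]]]].
  exists (l [*] u [+] (1 - l) [*] u'), (l [*] v [+] (1 - l) [*] v'), (l * c + (1 - l) * c'),
    (l * d + (1 - l) * d').
  split; [now apply CF|]. split; [now apply CG|]. split; [vlin|ring].
Qed.

Lemma epi_sum_above F G : eabove F -> eabove G -> eabove (epi_sum F G).
Proof.
  intros AF AG x f a [u [v [b [c [A1 [A2 [-> ->]]]]]]]. rewrite (lin_add (dual_lin f)).
  apply AF in A1. apply AG in A2. lra.
Qed.

(** If strength failed at [(f, p)], duality would give [q] with
    [F^* (f, p - q) + G^* (f, q) <= p f - eps], while strength of both summands bounds the left side
    below by [(p - q) f + q f = p f]. *)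
Lemma epi_sum_strong F G W : ecvx F -> eclosed F -> ecvx G -> eclosed G ->
  estrong F -> estrong G -> qualified F G W -> estrong (epi_sum F G).
Proof.
  intros CF ClF CG ClG SF SG Q f p eps Dp He. apply NNPP. intros Hno.
  destruct (@qualified_dual F G W f p (p f - eps) CF ClF CG ClG Q Dp) as [q [Dq Hq]].
  - intros u v g b c A1 A2. apply Rnot_lt_le. intros C. apply Hno.
    exists (u [+] v), g, (b + c). split.
    + exists u, v, b, c. auto.
    + rewrite (lin_add (dual_lin f)). lra.
  - destruct (SF f _ (eps / 4) (is_dual_comb 1 (-1) Dp Dq)) as [u [g [b [A1 B1]]]]; [lra|].
    destruct (SG f q (eps / 4) Dq) as [v [g' [c [A2 B2]]]]; [lra|].
    specialize (Hq _ _ _ _ _ _ A1 A2). rewrite (lin_sub (proj1 Dq)) in Hq. lra.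
Qed.

Definition dual_domain_in_X (S : op X) := forall (p : dual X -> R) (f : dual X), is_dual p ->
  (forall y g, S y g -> 0 <= g y - f y - p g + p f) -> exists x : X, forall g : dual X, p g = g x.

Lemma parallel_sum_represented S T F G W : represents S F -> represents T G -> qualified F G W ->
  dual_domain_in_X S \/ dual_domain_in_X T ->
  forall x f, parallel_sum S T x f <-> eclosure (epi_sum F G) x f (f x).
Proof.
  intros RS RT Q Hdom x f. split.
  - intros [u [v [Su [Tv ->]]]]. apply eclosure_sub. exists u, v, (f u), (f v).
    split; [now apply (rp_graph RS)|]. split; [now apply (rp_graph RT)|]. split; [reflexivity|].
    apply (lin_add (dual_lin f)).
  - intros Hx.
    assert (CE := epi_sum_cvx (rp_cvx RS) (rp_cvx RT)).
    assert (AE := epi_sum_above (rp_above RS) (rp_above RT)).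
    (* At a contact point the Fitzpatrick inequality says [h^* (f, x) <= f x], so the constant of
       the duality is [f x]. *)
    destruct (@qualified_dual F G W f (fun g => g x) (f x) (rp_cvx RS) (rp_closed RS) (rp_cvx RT)
                (rp_closed RT) Q (eval_is_dual x)) as [q [Dq Hq]].
    { intros u v g b c A1 A2.
      assert (A := @represented_fitzpatrick X _ x f (u [+] v) g (b + c)
        (eclosure_cvx CE) (eclosure_above AE) Hx). rewrite (lin_add (dual_lin f)) in A.
      assert (f u + f v + g x - (b + c) <= f x); [|lra]. apply A.
      apply eclosure_sub. exists u, v, b, c. auto. }
    assert (Lq := proj1 Dq).
    assert (Dxq := is_dual_comb 1 (-1) (eval_is_dual x) Dq).
    (* A negative pairing with a point of [S] would be made up by no point of [G]: strength of [G]
       at [(f, q)] would violate [Hq]. *)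
    assert (GS : forall u g, S u g -> 0 <= g u - f u - (1 * g x + -1 * q g) + (1 * f x + -1 * q f)).
    { intros u g Su. apply (rp_graph RS) in Su. apply Rnot_lt_le. intros C.
      match type of C with ?e < 0 => destruct (rp_strong RT f (eps := - e) Dq) as [v [g' [c [A1 B1]]]] end;
        [lra|].
      specialize (Hq _ _ _ _ _ _ Su A1). rewrite (lin_sub Lq) in Hq. lra. }
    assert (GT : forall v g, T v g -> 0 <= g v - f v - q g + q f).
    { intros v g Tv. apply (rp_graph RT) in Tv. apply Rnot_lt_le. intros C.
      match type of C with ?e < 0 => destruct (rp_strong RS f (eps := - e) Dxq) as [u [g' [c [A1 B1]]]] end;
        [lra|].
      specialize (Hq _ _ _ _ _ _ A1 Tv). rewrite (lin_sub Lq) in Hq. lra. }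
    (* Since [x] is a vector, [q] lies in [X] as soon as [x - q] does, so either domain hypothesis
       suffices. *)
    assert (Hq2 : exists v : X, forall g : dual X, q g = g v).
    { destruct Hdom as [HS|HT].
      - destruct (HS _ f Dxq GS) as [u Hu]. exists (x [-] u). intros g.
        rewrite (lin_sub (dual_lin g)), <- Hu. ring.
      - exact (HT q f Dq GT). }
    destruct Hq2 as [v Hv]. exists (x [-] v), v. split; [|split; [|vlin]].
    + apply (rp_max RS). intros y g Hyg. specialize (GS y g Hyg).
      rewrite !(lin_sub (dual_lin _)). rewrite !Hv in GS. lra.
    + apply (rp_max RT). intros y g Hyg. specialize (GT y g Hyg). rewrite !Hv in GT. lra.
Qed.

Theorem parallel_sum_typeD S T F G W : represents S F -> represents T G -> qualified F G W ->
  dual_domain_in_X S \/ dual_domain_in_X T -> gossez_typeD (parallel_sum S T).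
Proof.
  intros RS RT Q Hdom.
  replace (parallel_sum S T) with (fun x f => eclosure (epi_sum F G) x f (f x)).
  - apply represented_typeD.
    + apply eclosure_cvx, epi_sum_cvx; [apply RS|apply RT].
    + apply eclosure_closed.
    + apply eclosure_above, epi_sum_above; [apply RS|apply RT].
    + apply eclosure_strong. apply epi_sum_strong with W; try apply RS; try apply RT. exact Q.
  - apply functional_extensionality. intros x. apply functional_extensionality. intros f.
    apply propositional_extensionality. symmetry. now apply parallel_sum_represented with W.
Qed.
End Parallel.

(** * Strong representative functions *)

Section Representative.
Context {X : Banach}.

Definition epi (h : X -> dual X -> ereal) : X -> dual X -> R -> Prop :=
  fun x f a => exists b, h x f = Fin b /\ b <= a.

Definition pr_set (F : X -> dual X -> R -> Prop) : dset X := fun f => exists x a, F x f a.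

Lemma pr_set_epi h f : pr_set (epi h) f <-> pr_dom h f.
Proof.
  split.
  - intros [x [a [b [H _]]]]. now exists x, b.
  - intros [x [a H]]. exists x, a, a. split; [exact H|lra].
Qed.

Lemma maximal_monotone_rel (S : op X) x (f : dual X) : maximal_monotone S ->
  (forall y g, S y g -> 0 <= f x - g x - f y + g y) -> S x f.
Proof.
  intros [HM Hmax] H.
  apply (Hmax (fun y g => S y g \/ (y = x /\ g = f))); [|now left|right; auto].
  intros y g y' g' [H1|[-> ->]] [H2|[-> ->]]; rewrite monotone_pairing.
  - rewrite <- monotone_pairing. now apply HM.
  - specialize (H _ _ H1). lra.
  - now apply H.
  - lra.
Qed.

Lemma maximal_monotone_nonempty (S : op X) : maximal_monotone S -> exists x f, S x f.
Proof.
  intros HS. apply NNPP. intros H. apply H. exists bzero, (dzero X).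
  apply maximal_monotone_rel; [exact HS|]. intros y g Hyg. exfalso. eauto.
Qed.

Lemma strong_representative_represents (S : op X) h : (exists x : X, x <> bzero) ->
  maximal_monotone S -> strong_representative S h -> represents S (epi h).
Proof.
  intros HX HS [[Hc [Hl [Ha Hg]]] Hs]. constructor.
  - intros x f a y g b l Hl' [a' [A1 A2]] [b' [B1 B2]].
    destruct (Hc _ _ _ _ _ _ _ Hl' A1 B1) as [c [C1 C2]]. rewrite dcombE in C1.
    exists c. split; [exact C1|]. nra.
  - intros x f a H.
    (* Closed sublevel sets give the bound at each level above [a], because nearby values may exceed
       [a] slightly. *)
    assert (Ht : forall t, a < t -> exists b, h x f = Fin b /\ b <= t).
    { intros t Hat. apply (Hl t). intros eps He.
      assert (M1 := Rmin_l eps (t - a)). assert (M2 := Rmin_r eps (t - a)).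
      destruct (H (Rmin eps (t - a))) as [y [g [b [[b' [B1 B2]] [N1 [N2 N3]]]]]];
        [apply Rmin_pos; lra|].
      exists y, g. split; [exists b'; split; [exact B1|]|split; [lra|]].
      - assert (A := neg_abs_le (a - b)). lra.
      - rewrite dsubE. apply bnorm_dnorm_le. lra. }
    destruct (Ht (a + 1)) as [b [Hb _]]; [lra|]. exists b. split; [exact Hb|].
    apply Rnot_lt_le. intros C. destruct (Ht ((a + b) / 2)) as [b' [Hb' Hle]]; [lra|].
    rewrite Hb in Hb'. injection Hb' as <-. lra.
  - intros x f a [b [H1 H2]]. apply Ha in H1. lra.
  - intros f q eps Dq He. destruct (mk_bidual HX Dq) as [p Hp].
    destruct (Hs f p eps He) as [x [g [a [H1 H2]]]].
    exists x, g, a. split; [exists a; split; [exact H1|lra]|]. now rewrite <- !Hp.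
  - intros x f H. exists (f x). split; [now apply Hg|lra].
  - intros x f H. now apply maximal_monotone_rel.
Qed.

Lemma bidual_domain_in_X (S : op X) : (exists x : X, x <> bzero) ->
  (forall p f, gossez S p f -> in_X p) -> dual_domain_in_X S.
Proof.
  intros HX H q f Dq Hq. destruct (mk_bidual HX Dq) as [p Hp].
  destruct (H p f) as [x Hx].
  - apply gossez_pairing. intros y g Hyg. rewrite !Hp. now apply Hq.
  - exists x. intros g. now rewrite <- Hp.
Qed.

(** * Translation of an operator by a functional *)

Definition shift_op (z : dual X) (T : op X) : op X := fun x f => T x (f [-] z).
(** The operator [T + z] is represented by [h (x, f - z) + z x]. *)
Definition shift_epi (z : dual X) (G : X -> dual X -> R -> Prop) : X -> dual X -> R -> Prop :=
  fun x f a => G x (f [-] z) (a - z x).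

Lemma shift_add_sub (f z : dual X) : (f [+] z) [-] z = f.
Proof. dual_ring. Qed.

Lemma shift_represents z (T : op X) G : represents T G ->
  represents (shift_op z T) (shift_epi z G).
Proof.
  intros RT. unfold shift_op, shift_epi. constructor.
  - intros x f a y g b l Hl H1 H2. assert (H := @rp_cvx _ _ _ RT _ _ _ _ _ _ _ Hl H1 H2).
    replace ((l [*] f [+] (1 - l) [*] g) [-] z)
      with (l [*] (f [-] z) [+] (1 - l) [*] (g [-] z)) by dual_ring.
    rewrite (lin_add (dual_lin z)), !(lin_scal (dual_lin z)).
    replace (l * a + (1 - l) * b - (l * z x + (1 - l) * z y))
      with (l * (a - z x) + (1 - l) * (b - z y)) by ring. exact H.
  - intros x f a H. apply (rp_closed RT). intros eps He. assert (Pz := b_norm_ge0 _ z).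
    set (e := eps / (1 + bnorm z)).
    assert (He' : 0 < e) by (unfold e; apply Rdiv_lt_0_compat; lra).
    assert (Ee : e * (1 + bnorm z) = eps) by (unfold e; field; lra).
    destruct (H e He') as [y [g [b [Hb [N1 [N2 N3]]]]]].
    exists y, (g [-] z), (b - z y). split; [exact Hb|]. split; [nra|]. split.
    + replace ((f [-] z) [-] (g [-] z)) with (f [-] g) by dual_ring. nra.
    + assert (A := dual_bound z (x [-] y)). rewrite (lin_sub (dual_lin z)) in A.
      assert (T1 := Rabs_triang (a - b) (- (z x - z y))). rewrite Rabs_Ropp in T1.
      replace (a - b + - (z x - z y)) with (a - z x - (b - z y)) in T1 by ring. nra.
  - intros x f a H. apply (rp_above RT) in H. rewrite deval_sub in H. lra.
  - intros f p eps Dp He. assert (Lp := proj1 Dp).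
    destruct (rp_strong RT (f [-] z) Dp He) as [x [g [a [H1 H2]]]].
    exists x, (g [+] z), (a + z x). split.
    + rewrite shift_add_sub. now replace (a + z x - z x) with a by ring.
    + rewrite (lin_sub Lp), deval_sub in H2. rewrite (lin_add Lp). lra.
  - intros x f H. apply (rp_graph RT) in H. now rewrite deval_sub in H.
  - intros x f H. apply (rp_max RT). intros y g Hyg. specialize (H y (g [+] z)).
    rewrite shift_add_sub in H. specialize (H Hyg). rewrite !deval_add in H.
    rewrite !deval_sub. lra.
Qed.

Lemma shift_domain_in_X z (T : op X) : dual_domain_in_X T -> dual_domain_in_X (shift_op z T).
Proof.
  intros H p f Dp Hp. assert (Lp := proj1 Dp). apply (H p (f [-] z) Dp). intros y g Hyg.
  specialize (Hp y (g [+] z)). unfold shift_op in Hp. rewrite shift_add_sub in Hp.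
  specialize (Hp Hyg). rewrite deval_add, (lin_add Lp) in Hp. rewrite deval_sub, (lin_sub Lp). lra.
Qed.

(* If [g] were at positive distance from [co (range S)], a separating functional [L] would put
   [(u - n L, g)] in Gossez's closure of [S] for large [n], and type (D) would bring [g] back into
   the closure of the range. *)
Lemma pr_set_sub_closure_range (S : op X) F u (g : dual X) b : (exists x : X, x <> bzero) ->
  gossez_typeD S -> represents S F -> F u g b -> nclosure (co (range S)) g.
Proof.
  intros HX [HS HD] RS Hug eps He. apply NNPP. intros Hno.
  assert (Hfar : forall h, co (range S) h -> eps < bnorm (g [-] h)).
  { intros h Hh. apply Rnot_le_lt. intros C. apply Hno. eauto. }
  destruct (@fenchel_sandwich (dualB X)
    (fun w a => exists h, co (range S) h /\ w = h [-] g /\ a = 0) (fun w => 1 * bnorm w) eps)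
    as [L [LL HL]].
  - destruct (maximal_monotone_nonempty HS) as [x [f Hxf]]. do 2 eexists. exists f.
    split; [|split; reflexivity]. intros C _ HC. apply HC. now exists x.
  - intros w a w' a' l Hl [h [H1 [-> ->]]] [h' [H2 [-> ->]]].
    exists (l [*] h [+] (1 - l) [*] h'). split; [|split; [|ring]].
    + intros C CC HC. rewrite <- dcombE. apply CC; [now apply H1|now apply H2|exact Hl].
    + dual_ring.
  - apply norm_cvx. lra.
  - intros w a [h [H1 [-> ->]]]. rewrite bnorm_sub_sym. specialize (Hfar h H1). lra.
  - assert (HL' : forall h, co (range S) h -> eps <= L h - L g).
    { intros h Hh. rewrite <- (lin_sub LL).
      assert (A : L bzero - L (h [-] g) <= 0 + 1 * bnorm (@bzero (dualB X)) - eps)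
        by (apply HL; eauto).
      rewrite (lin_zero LL), bnorm0 in A. lra. }
    assert (DL : is_dual L).
    { destruct (maximal_monotone_nonempty HS) as [x [f Hxf]].
      assert (Hf : co (range S) f) by (intros C _ HC; apply HC; now exists x).
      apply (lin_bounded_dual LL) with (L (f [-] g) + 1). intros w Hw.
      assert (A : L w - L (f [-] g) <= 0 + 1 * bnorm w - eps) by (apply HL; eauto). lra. }
    assert (Hb := rp_above RS _ _ _ Hug).
    (* Fitzpatrick's inequality loses at most [b - g u], and each unit of [n] regains at least
       [eps]. *)
    set (n := (b - g u) / eps).
    assert (Hn : n * eps = b - g u) by (unfold n; field; lra).
    assert (Hn0 : 0 <= n).
    { unfold n. apply Rmult_le_pos; [lra|]. left. now apply Rinv_0_lt_compat. }
    destruct (mk_bidual HX (is_dual_comb 1 (- n) (eval_is_dual u) DL)) as [p Hp].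
    destruct (HD p g) as [I [le [xs [fs [[_ [Hrefl _]] [HI [_ [_ Hconv]]]]]]]].
    + apply gossez_pairing. intros y h Hyh. rewrite !Hp.
      assert (A := @represented_fitzpatrick _ _ _ _ _ _ _ (rp_cvx RS) (rp_above RS) (rp_graph RS _ _ Hyh) Hug).
      assert (B : eps <= L h - L g) by (apply HL'; intros C _ HC; apply HC; now exists y).
      assert (n * eps <= n * (L h - L g)) by (apply Rmult_le_compat_l; lra). lra.
    + destruct (Hconv eps He) as [i Hi]. specialize (Hi i (Hrefl i)).
      rewrite dsubE in Hi. apply dnorm_le_bnorm in Hi; [|lra].
      rewrite bnorm_sub_sym in Hi.
      assert (A : eps < bnorm (g [-] fs i)); [|lra].
      apply Hfar. intros C _ HC. apply HC. now exists (xs i).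
Qed.
End Representative.

(** * Affine hulls and relative interiors *)

Section AffineHull.
Context {X : Banach}.
Implicit Types (A B D : dset X) (f g v w z : dual X).

Lemma affineE D : affine D <-> forall v w l, D v -> D w -> D (l [*] v [+] (1 - l) [*] w).
Proof.
  split; intros H v w l Hv Hw; [rewrite <- dcombE|rewrite dcombE]; now apply H.
Qed.

Lemma affine_aff D : affine (aff D).
Proof. intros v w l Hv Hw C HC Hsub. apply HC; [now apply Hv|now apply Hw]. Qed.

Lemma aff_sub D v : D v -> aff D v.
Proof. intros Hv C _ Hsub. now apply Hsub. Qed.

Lemma aff_min D C : affine C -> (forall v, D v -> C v) -> forall v, aff D v -> C v.
Proof. intros HC Hsub v Hv. now apply Hv. Qed.

Lemma aff_comb D v w l : aff D v -> aff D w -> aff D (l [*] v [+] (1 - l) [*] w).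
Proof. apply affineE, affine_aff. Qed.

Lemma set_diffE A B z : set_diff A B z <-> exists a b, A a /\ B b /\ z = a [-] b.
Proof. split; intros [a [b H]]; exists a, b; now rewrite dsubE in *. Qed.

Lemma closed_dE D : closed_d D <-> forall v, nclosure D v -> D v.
Proof.
  split; intros H v Hv; apply H; intros eps He; destruct (Hv eps He) as [w [Hw N]]; exists w;
    (split; [exact Hw|]); [rewrite dsubE; now apply bnorm_dnorm_le|].
  rewrite dsubE in N. apply dnorm_le_bnorm in N; [exact N|lra].
Qed.

(** Together with [aff_translate] this identifies [aff (set_diff D D)] as the linear space parallel
    to [aff D]; each point is moved separately. *)
Lemma aff_set_diff D v w : aff D v -> aff D w -> aff (set_diff D D) (v [-] w).
Proof.
  intros Hv Hw.
  assert (H : forall d, D d -> aff (set_diff D D) (v [-] d)).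
  { intros d Hd.
    apply (@aff_min D (fun v => aff (set_diff D D) (v [-] d))); [|intros u Hu|exact Hv].
    - apply affineE. intros a b l Ha Hb.
      replace ((l [*] a [+] (1 - l) [*] b) [-] d)
        with (l [*] (a [-] d) [+] (1 - l) [*] (b [-] d)) by dual_ring.
      now apply aff_comb.
    - apply aff_sub, set_diffE. now exists u, d. }
  apply (@aff_min D (fun w => aff (set_diff D D) (v [-] w))); [|exact H|exact Hw].
  apply affineE. intros a b l Ha Hb.
  replace (v [-] (l [*] a [+] (1 - l) [*] b))
    with (l [*] (v [-] a) [+] (1 - l) [*] (v [-] b)) by dual_ring.
  now apply aff_comb.
Qed.

Lemma aff_translate D z v : aff (set_diff D D) v -> aff D z -> forall l, aff D (z [+] l [*] v).
Proof.
  intros Hv Hz l. revert z Hz.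
  apply (@aff_min (set_diff D D) (fun v => forall z, aff D z -> aff D (z [+] l [*] v))); [| |exact Hv].
  - apply affineE. intros a b t Ha Hb z Hz.
    replace (z [+] l [*] (t [*] a [+] (1 - t) [*] b))
      with (t [*] (z [+] l [*] a) [+] (1 - t) [*] (z [+] l [*] b))
      by dual_ring.
    apply aff_comb; auto.
  - intros d Hd z Hz. apply set_diffE in Hd. destruct Hd as [a [b [Ha [Hb ->]]]].
    replace (z [+] l [*] (a [-] b))
      with (2 [*] (/ 2 [*] z [+] (1 - / 2) [*] (l [*] a [+] (1 - l) [*] b)) [+] (1 - 2) [*] b)
      by dual_ring.
    apply aff_sub in Ha. apply aff_sub in Hb. repeat apply aff_comb; assumption.
Qed.

(** For empty [D] the condition [icr] holds vacuously everywhere; otherwise the zero direction with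
    [l = 0] gives membership. *)
Lemma icr_mem D z : (exists d, D d) -> icr D z -> D z.
Proof.
  intros [d Hd] H. destruct (H (d [-] d)) as [e [He Hl]].
  - now apply aff_set_diff; apply aff_sub.
  - specialize (Hl 0 ltac:(lra)). rewrite dcombE in Hl.
    now replace z with (1 [*] z [+] 0 [*] (d [-] d)) by dual_ring.
Qed.

Lemma ri_sub_ic D z : ri D z -> ic D z.
Proof.
  intros [Hcl [Hz [eps [He Hball]]]]. split; [exact Hcl|]. intros v Hv.
  assert (Pv := b_norm_ge0 _ v). exists (eps / (1 + bnorm v)).
  split; [apply Rdiv_lt_0_compat; lra|]. intros l [Hl0 Hl1]. rewrite dcombE.
  replace (1 [*] z [+] l [*] v) with (z [+] l [*] v) by dual_ring.
  apply Hball.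
  - apply aff_translate; [exact Hv|now apply aff_sub].
  - rewrite dsubE. apply bnorm_dnorm_le.
    replace ((z [+] l [*] v) [-] z) with (l [*] v) by dual_ring.
    rewrite bnorm_pscal by exact Hl0.
    apply Rmult_le_compat_r with (r := 1 + bnorm v) in Hl1; [|lra].
    unfold Rdiv in Hl1. rewrite Rmult_assoc, Rinv_l in Hl1 by lra. nra.
Qed.

Lemma ic_superset D D' z : (forall v, D v -> D' v) -> (forall v, D' v -> aff D v) ->
  ic D z -> ic D' z.
Proof.
  intros H1 H2 [Hcl Hi].
  assert (H3 : forall v, aff D v -> aff D' v).
  { apply aff_min; [apply affine_aff|]. intros v Hv. now apply aff_sub, H1. }
  assert (H4 : forall v, aff D' v -> aff D v) by (apply aff_min; [apply affine_aff|exact H2]).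
  split.
  - intros f Hf. apply H3, Hcl. intros eps He. destruct (Hf eps He) as [g [Hg N]]. eauto.
  - intros v Hv. destruct (Hi v) as [d [Hd Hl]].
    + revert v Hv. apply aff_min; [apply affine_aff|]. intros v Hv. apply set_diffE in Hv.
      destruct Hv as [a [b [Ha [Hb ->]]]]. apply aff_set_diff; auto.
    + exists d. split; [exact Hd|]. intros l Hl'. apply H1. now apply Hl.
Qed.

Lemma ri_ball D z : ri D z ->
  exists eps, 0 < eps /\ forall v, aff D v -> bnorm (v [-] z) <= eps -> ri D v.
Proof.
  intros [Hcl [Hz [eps [He Hball]]]]. exists (eps / 2). split; [lra|]. intros v Hv Hvz.
  split; [exact Hcl|]. split.
  - apply Hball; [exact Hv|]. rewrite dsubE. apply bnorm_dnorm_le. lra.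
  - exists (eps / 2). split; [lra|]. intros w Hw N. apply Hball; [exact Hw|].
    rewrite dsubE in N |- *. apply dnorm_le_bnorm in N; [|lra]. apply bnorm_dnorm_le.
    assert (T := bnorm_sub_tri w v z). lra.
Qed.

(** A relative ball around [z] lies in [ri D], hence in [D']; as it spans [aff D], both affine hulls
    agree. *)
Lemma ri_subset D D' z : (forall v, ri D v -> D' v) -> (forall v, D' v -> D v) ->
  ri D z -> ri D' z.
Proof.
  intros H1 H2 Hz. destruct (ri_ball Hz) as [eps [He Hball]].
  assert (H3 : forall v, aff D' v -> aff D v).
  { apply aff_min; [apply affine_aff|]. intros v Hv. now apply aff_sub, H2. }
  assert (Dz := proj1 (proj2 Hz)).
  assert (H4 : forall v, aff D v -> aff D' v).
  { intros v Hv. assert (P := b_norm_ge0 _ (v [-] z)). set (t := eps / (1 + bnorm (v [-] z))).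
    assert (Ht : 0 < t) by (unfold t; apply Rdiv_lt_0_compat; lra).
    assert (Et : t * (1 + bnorm (v [-] z)) = eps) by (unfold t; field; lra).
    replace v with ((/ t) [*] (t [*] v [+] (1 - t) [*] z) [+] (1 - / t) [*] z)
      by dual_ring.
    apply aff_comb; apply aff_sub, H1; [|exact Hz]. apply Hball.
    - apply aff_comb; [exact Hv|now apply aff_sub].
    - replace ((t [*] v [+] (1 - t) [*] z) [-] z) with (t [*] (v [-] z))
        by dual_ring.
      rewrite bnorm_pscal by lra. nra. }
  split; [|split].
  - intros f Hf. apply H4, (proj1 Hz). intros e He'. destruct (Hf e He') as [g [Hg N]]. eauto.
  - now apply H1.
  - exists eps. split; [exact He|]. intros v Hv N. apply H1, Hball; [now apply H3|].
    rewrite dsubE in N. apply dnorm_le_bnorm in N; [exact N|lra].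
Qed.
End AffineHull.

(** * The qualification condition *)

Section Qualification.
Context {X : Banach}.
Variables S T : op X.
Variables F G : X -> dual X -> R -> Prop.
Hypothesis RS : represents S F.
Hypothesis RT : represents T G.
Let P : dset X := set_diff (pr_set F) (pr_set G).

Lemma pr_set_nonempty (U : op X) H : represents U H -> exists g, pr_set H g.
Proof.
  intros RU. destruct (rp_strong RU (dzero X) (@is_dual_zero (dualB X)) Rlt_0_1) as [x [g [a [A _]]]].
  now exists g, x, a.
Qed.

Lemma ic_mem z : ic P z -> P z.
Proof.
  intros [_ Hi]. apply icr_mem; [|exact Hi].
  destruct (pr_set_nonempty RS) as [f Hf]. destruct (pr_set_nonempty RT) as [g Hg].
  exists (f [-] g). apply set_diffE. eauto.
Qed.

Lemma shift_pr (z g : dual X) v c : G v g c -> shift_epi z G v (g [+] z) (c + z v).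
Proof.
  intros H. unfold shift_epi. rewrite shift_add_sub. now replace (c + z v - z v) with c by ring.
Qed.

(** Translating [G] by [z] moves [z] to the origin; [W] is [aff P - z], and absorption is the
    definition of [icr]. *)
Lemma ic_qualified z : ic P z -> qualified F (shift_epi z G) (fun w => aff P (z [+] w)).
Proof.
  intros Hz. assert (Pz := ic_mem Hz). assert (Az := aff_sub P z Pz).
  assert (Wscal : forall a v, aff P (z [+] v) -> aff P (z [+] a [*] v)).
  { intros a v Hv. replace (z [+] a [*] v) with (a [*] (z [+] v) [+] (1 - a) [*] z)
      by dual_ring. now apply aff_comb. }
  constructor.
  - intros a v w Hv Hw.
    replace (z [+] (a [*] v [+] w))
      with (/ 2 [*] (z [+] (2 * a) [*] v) [+] (1 - / 2) [*] (z [+] 2 [*] w))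
      by dual_ring.
    apply aff_comb; now apply Wscal.
  - intros w Hw. apply (proj1 (closed_dE _) (proj1 Hz)). intros eps He.
    destruct (Hw eps He) as [y [Hy N]]. exists (z [+] y). split; [exact Hy|].
    now replace ((z [+] w) [-] (z [+] y)) with (w [-] y) by dual_ring.
  - intros u g b v g' c Hu Hv. apply aff_sub, set_diffE. exists g, (g' [-] z).
    split; [now exists u, b|]. split; [now exists v, (c - z v)|].
    dual_ring.
  - apply set_diffE in Pz. destruct Pz as [g [g' [[u [b Hu]] [[v [c Hv]] ->]]]].
    exists u, g, b, v, (c + dapp (g [-] g') v). split; [exact Hu|].
    apply shift_pr with (z := g [-] g') in Hv.
    now replace (g' [+] (g [-] g')) with g in Hv by dual_ring.
  - intros w Hw. destruct (proj2 Hz w) as [d [Hd Hl]].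
    + replace w with ((z [+] w) [-] z) by dual_ring.
      now apply aff_set_diff.
    + exists d. split; [exact Hd|]. intros l Hl'. specialize (Hl l Hl'). rewrite dcombE in Hl.
      apply set_diffE in Hl. destruct Hl as [g [g' [[u [b Hu]] [[v [c Hv]] E]]]].
      exists u, g, b, v, (g' [+] z), (c + z v). split; [exact Hu|]. split; [now apply shift_pr|].
      replace (l [*] w) with ((1 [*] z [+] l [*] w) [-] z) by dual_ring.
      rewrite E. dual_ring.
Qed.

(** [qualified_ball] fills a whole relative ball around [z] with differences of the projections. *)
Lemma ic_sub_ri z : ic P z -> ri P z.
Proof.
  intros Hz. assert (RT' := shift_represents z RT).
  destruct (qualified_ball (rp_cvx RS) (rp_closed RS) (rp_cvx RT') (rp_closed RT') (ic_qualified Hz))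
    as [r [K [Hr HK]]].
  split; [apply Hz|]. split; [now apply ic_mem|]. exists r. split; [exact Hr|].
  intros v Hv N. rewrite dsubE in N. apply dnorm_le_bnorm in N; [|lra].
  destruct (HK (v [-] z)) as [u [g [b [v' [g' [c [A1 [A2 [A3 _]]]]]]]]].
  - now replace (z [+] (v [-] z)) with v by dual_ring.
  - exact N.
  - apply set_diffE. exists g, (g' [-] z). split; [now exists u, b|].
    split; [now exists v', (c - z v')|].
    replace v with ((v [-] z) [+] z) by dual_ring.
    rewrite A3. dual_ring.
Qed.

Lemma ic_shift_typeD z : dual_domain_in_X S \/ dual_domain_in_X T -> ic P z ->
  gossez_typeD (parallel_sum S (shift_op z T)).
Proof.
  intros Hdom Hz. apply (parallel_sum_typeD RS (shift_represents z RT) (ic_qualified Hz)).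
  destruct Hdom as [H|H]; [now left|right; now apply shift_domain_in_X].
Qed.

Lemma ic_sub_range z : dual_domain_in_X S \/ dual_domain_in_X T -> ic P z ->
  set_diff (range S) (range T) z.
Proof.
  intros Hdom Hz. destruct (ic_shift_typeD Hdom Hz) as [HM _].
  destruct (maximal_monotone_nonempty HM) as [x [f [u [v [Su [Tv _]]]]]].
  apply set_diffE. exists f, (f [-] z). split; [now exists u|]. split; [now exists v|].
  dual_ring.
Qed.

Lemma range_sub_pr (U : op X) H g : represents U H -> co (range U) g -> pr_set H g.
Proof.
  intros RU Hg. apply Hg.
  - intros f h l [x [a Ha]] [y [b Hb]] Hl. rewrite dcombE.
    exists (l [*] x [+] (1 - l) [*] y), (l * a + (1 - l) * b). now apply (rp_cvx RU).
  - intros f [x Hx]. exists x, (f x). now apply (rp_graph RU).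
Qed.

(** One argument at a time: with the other fixed, the functionals whose difference lies in the
    affine hull form a convex set. *)
Lemma diff_co_sub_aff (A B : dset X) g : set_diff (co A) (co B) g -> aff (set_diff A B) g.
Proof.
  intros H. apply set_diffE in H. destruct H as [a [b [Ha [Hb ->]]]].
  assert (Haff : forall b', B b' -> aff (set_diff A B) (a [-] b')).
  { intros b' Hb'. apply (Ha (fun a => aff (set_diff A B) (a [-] b'))).
    - intros f h l Hf Hh _. rewrite dcombE.
      replace ((l [*] f [+] (1 - l) [*] h) [-] b')
        with (l [*] (f [-] b') [+] (1 - l) [*] (h [-] b')) by dual_ring.
      now apply aff_comb.
    - intros f Hf. apply aff_sub, set_diffE. eauto. }
  apply (Hb (fun b => aff (set_diff A B) (a [-] b))); [|exact Haff].
  intros f h l Hf Hh _. rewrite dcombE.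
  replace (a [-] (l [*] f [+] (1 - l) [*] h))
    with (l [*] (a [-] f) [+] (1 - l) [*] (a [-] h)) by dual_ring.
  now apply aff_comb.
Qed.

Lemma pr_diff_closure g : (exists x : X, x <> bzero) -> gossez_typeD S -> gossez_typeD T ->
  P g -> nclosure (set_diff (co (range S)) (co (range T))) g.
Proof.
  intros HX HS HT Hg eps He. apply set_diffE in Hg.
  destruct Hg as [f [h [[u [b Hu]] [[v [c Hv]] ->]]]].
  assert (He2 : 0 < eps / 2) by lra.
  destruct (pr_set_sub_closure_range _ _ _ HX HS RS Hu He2) as [f' [Hf' Nf]].
  destruct (pr_set_sub_closure_range _ _ _ HX HT RT Hv He2) as [h' [Hh' Nh]].
  exists (f' [-] h'). split; [apply set_diffE; eauto|].
  replace ((f [-] h) [-] (f' [-] h')) with ((f [-] f') [-] (h [-] h'))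
    by dual_ring.
  assert (A := bnorm_sub_le (f [-] f') (h [-] h')). lra.
Qed.

(** Stated for any [D] between the two differences, so one cycle [ic D], [ic P], [ri D], [ic D]
    serves ranges and convex hulls alike. For the first inclusion, a closed [aff D] contains the
    closure of the larger difference and thus [P]. *)
Lemma intermediate_interiors (D : dset X) z : (exists x : X, x <> bzero) ->
  gossez_typeD S -> gossez_typeD T -> dual_domain_in_X S \/ dual_domain_in_X T ->
  (forall v, set_diff (range S) (range T) v -> D v) ->
  (forall v, D v -> set_diff (co (range S)) (co (range T)) v) ->
  (ic D z <-> ic P z) /\ (ri D z <-> ic P z).
Proof.
  intros HX HS HT Hdom HAD HDB.
  assert (HBP : forall v, set_diff (co (range S)) (co (range T)) v -> P v).
  { intros v Hv. apply set_diffE in Hv. destruct Hv as [a [b [Ha [Hb ->]]]]. apply set_diffE.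
    exists a, b. split; [now apply (range_sub_pr RS)|]. split; [now apply (range_sub_pr RT)|reflexivity]. }
  assert (H1 : ic D z -> ic P z).
  { intros Hz. apply (@ic_superset X D); [intros v Hv; now apply HBP, HDB| |exact Hz].
    intros v Hv. apply (proj1 (closed_dE _) (proj1 Hz)). intros eps He.
    destruct (pr_diff_closure HX HS HT Hv He) as [w [Hw N]]. exists w. split; [|exact N].
    apply diff_co_sub_aff in Hw. clear N. revert w Hw. apply aff_min; [apply affine_aff|]. intros w Hw. now apply aff_sub, HAD. }
  assert (H2 : ic P z -> ri D z).
  { intros Hz. apply (@ri_subset X P); [|intros v Hv; now apply HBP, HDB|now apply ic_sub_ri].
    intros v Hv. apply HAD, ic_sub_range; [exact Hdom|now apply ri_sub_ic]. }
  assert (H3 := @ri_sub_ic X D z). tauto.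
Qed.
End Qualification.

Theorem theorem4p3 (X : Banach) (S T : op X) (hS hT : X -> dual X -> ereal)
  (HX : exists x : X, x <> bzero)
  (HSD : gossez_typeD S) (HTD : gossez_typeD T)
  (HhS : strong_representative S hS) (HhT : strong_representative T hT)
  (Hint : exists f, pr_dom hS f /\ pr_dom hT f)
  (Hdom : (forall p f, gossez S p f -> in_X p) \/ (forall p f, gossez T p f -> in_X p)) :
  let A := set_diff (range S) (range T) in
  let B := set_diff (co (range S)) (co (range T)) in
  let P := set_diff (pr_dom hS) (pr_dom hT) in
  let z := dzero X in
  (* (a) *)
  (set_eq (ic A) (ri A) /\ set_eq (ri A) (ic B) /\ set_eq (ic B) (ri B) /\
   set_eq (ri B) (ic P) /\ set_eq (ic P) (ri P)) /\
  (* (b) equivalence *)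
  ((ic A z <-> ri A z) /\ (ri A z <-> ic B z) /\ (ic B z <-> ri B z) /\
   (ri B z <-> ic P z) /\ (ic P z <-> ri P z)) /\
  (* (b) each implies S||T maximal monotone of type (D) *)
  ((ic A z \/ ri A z \/ ic B z \/ ri B z \/ ic P z \/ ri P z) ->
   gossez_typeD (parallel_sum S T)).
Proof.
  intros A B P z.
  assert (RS := strong_representative_represents HX (proj1 HSD) HhS).
  assert (RT := strong_representative_represents HX (proj1 HTD) HhT).
  assert (Hdom' : dual_domain_in_X S \/ dual_domain_in_X T).
  { destruct Hdom as [H|H]; [left|right]; now apply bidual_domain_in_X. }
  assert (EP : P = set_diff (pr_set (epi hS)) (pr_set (epi hT))).
  { unfold P. f_equal; apply functional_extensionality; intros f;
      apply propositional_extensionality; symmetry; apply pr_set_epi. }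
  assert (HAB : forall v, A v -> B v).
  { intros v [a [b [Ha [Hb ->]]]]. exists a, b.
    split; [intros C _ HC; now apply HC|]. split; [intros C _ HC; now apply HC|reflexivity]. }
  assert (HA : forall v, (ic A v <-> ic P v) /\ (ri A v <-> ic P v)).
  { intros v. rewrite EP. now apply (intermediate_interiors RS RT). }
  assert (HB : forall v, (ic B v <-> ic P v) /\ (ri B v <-> ic P v)).
  { intros v. rewrite EP. now apply (intermediate_interiors RS RT). }
  assert (HP : forall v, ic P v <-> ri P v).
  { intros v. split; [|apply ri_sub_ic]. rewrite EP. now apply (ic_sub_ri RS RT). }
  split; [|split].
  - split; [|split; [|split; [|split]]]; intros v;
      specialize (HA v); specialize (HB v); specialize (HP v); tauto.
  - specialize (HA z). specialize (HB z). specialize (HP z). tauto.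
  - intros H. assert (Hz : ic P z).
    { specialize (HA z). specialize (HB z). specialize (HP z). tauto. }
    rewrite EP in Hz. assert (HD := ic_shift_typeD RS RT Hdom' Hz).
    (* Here [z] is the zero functional, so the translation is the identity. *)
    replace (shift_op z T) with T in HD; [exact HD|].
    apply functional_extensionality. intros x. apply functional_extensionality. intros f.
    unfold shift_op. f_equal. dual_ring.
Qed.
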